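(* Let $n\in\mathbb{N}$ and suppose $\widetilde T_n=\sum_{\gamma}\nu_\gamma\gamma\in\mathcal{R}_n$ acts like the $n$-th Hecke operator on periods, i.e. there is $Y\in\mathcal{R}_n$ with $(1-S)\widetilde T_n=T_n^{\infty}(1-S)+(1-T)Y$, and that every matrix $\gamma$ occurring in $\widetilde T_n$ (with $\nu_\gamma\neq0$) has a representative with nonnegative entries. Then there is a constant $K$ such that for all $x>0$ \[\bigl(\mathcal{F}|_0\widetilde T_n\bigr)(x)-\sigma(n)\mathcal{F}(x)-\sum_{\gamma(\infty)\ne\infty}\nu_\gamma\,L\bigl(\gamma(x)/\gamma(\infty)\bigr)=A_n\log x+K,\] where $A_n=\frac12\sum_{l\mid n}l\log(l^2/n)$, $\sigma(n)=\sum_{d\mid n}d$, and for $\gamma=[\begin{smallmatrix}a&b\\c&d\end{smallmatrix}]$ we write $\gamma(x)=\frac{ax+b}{cx+d}$, $\gamma(\infty)=a/c$.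
   Context: Let $\psi=\Gamma'/\Gamma$ and $F(x)=\sum_{n\ge1}\frac{\psi(nx)-\log(nx)}{n}$ for $x\in\mathbb{C}\setminus(-\infty,0]$; $\mathcal{F}(x)=F(x)-F(1)+\frac{\pi^2}{12}(x-2+x^{-1})-\frac{\log^2x}{4}$. The Rogers dilogarithm $L\colon\mathbb{R}\to\mathbb{R}$ is $L(x)=\mathrm{Li}_2(x)+\frac12\log(x)\log(1-x)$ for $x\in[0,1]$ (with $L(0)=0$, $L(1)=\pi^2/6$), $L(x)=\frac{\pi^2}{3}-L(1/x)$ for $x>1$, and $L(x)=-L\bigl(\frac{x}{x-1}\bigr)$ for $x<0$. For $n\in\mathbb{N}$, $\mathcal{M}_n$ is the set of $2\times2$ integer matrices of determinant $n$ modulo $\pm1$, $\mathcal{R}_n=\mathbb{Q}[\mathcal{M}_n]$, $\mathcal{R}=\bigoplus_n\mathcal{R}_n$ with multiplication from matrix multiplication; $1$ is the identity, $S=[\begin{smallmatrix}0&-1\\1&0\end{smallmatrix}]$, $T=[\begin{smallmatrix}1&1\\0&1\end{smallmatrix}]$, $T_n^\infty=\sum_{ad=n}\sum_{0\le b<d}[\begin{smallmatrix}a&b\\0&d\end{smallmatrix}]$. The weight-$0$ slash action is $(f|_0\gamma)(x)=f\bigl(\frac{ax+b}{cx+d}\bigr)$, extended linearly to $\mathcal{R}$. *)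

(* Defs.v *)
From HB Require Import structures.
From mathcomp Require Import all_boot all_order all_algebra.
From mathcomp Require Import all_classical all_reals all_analysis.
From mathcomp Require Import finmap.
(* The notations of monalg are incompatible with those of all_analysis. *)
From mathcomp Require Import -(notations) monalg.

Set Implicit Arguments.
Unset Strict Implicit.
Unset Printing Implicit Defensive.

Import Order.TTheory GRing.Theory Num.Theory.
Import numFieldNormedType.Exports.

Local Open Scope quotient_scope.
Local Open Scope classical_set_scope.
Local Open Scope ring_scope.

Section ProjectiveMatrices.

Definition pm_eqv (g h : 'M[int]_2) : bool := (g == h) || (g == - h).

Fact pm_eqv_refl : reflexive pm_eqv.
Proof. by move=> g; rewrite /pm_eqv eqxx. Qed.

Fact pm_eqv_sym : symmetric pm_eqv.
Proof. by move=> g h; rewrite /pm_eqv eq_sym -eqr_oppLR (eq_sym (- g)). Qed.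

Fact pm_eqv_trans : transitive pm_eqv.
Proof.
move=> h g k; rewrite /pm_eqv.
by case/orP=> /eqP-> /orP[]/eqP->; rewrite ?opprK eqxx ?orbT.
Qed.

Canonical pm_eqv_equiv := EquivRel pm_eqv pm_eqv_refl pm_eqv_sym pm_eqv_trans.

(* 2 x 2 integer matrices modulo +-1, with no condition on the determinant. *)
Definition pmx : Type := {eq_quot pm_eqv_equiv}.

HB.instance Definition _ := Choice.on pmx.
HB.instance Definition _ := EqQuotient.on pmx.

Definition pm (g : 'M[int]_2) : pmx := \pi_pmx g.

Definition mx2 (a b c d : int) : 'M[int]_2 :=
  \matrix_(i, j) (if i == 0 then if j == 0 then a else b
                  else if j == 0 then c else d).

Definition pdet (g : pmx) : int := \det (repr g).

Definition pmul (g h : pmx) : pmx := pm (repr g *m repr h).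

Lemma eq_pm (g h : 'M[int]_2) : (pm g = pm h) <-> (g = h \/ g = - h).
Proof.
split=> [/eqmodP|H]; last apply/eqmodP.
  by case/orP=> /eqP->; [left | right].
by rewrite /= /pm_eqv; case: H => ->; rewrite eqxx ?orbT.
Qed.

Lemma repr_pm (g : 'M[int]_2) : repr (pm g) = g \/ repr (pm g) = - g.
Proof. by apply/eq_pm; rewrite /pm reprK. Qed.

Lemma pdetE (g : 'M[int]_2) : pdet (pm g) = \det g.
Proof.
rewrite /pdet; case: (repr_pm g) => -> //.
by rewrite -scaleN1r detZ -signr_odd expr0 mul1r.
Qed.

Lemma pmulE (g h : 'M[int]_2) : pmul (pm g) (pm h) = pm (g *m h).
Proof.
apply/eq_pm.
by case: (repr_pm g) => ->; case: (repr_pm h) => ->;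
  rewrite ?mulNmx ?mulmxN ?opprK; auto.
Qed.

End ProjectiveMatrices.

Section HeckeRing.

(* Finite formal Q-combinations of elements of pmx.  It contains the graded   *)
(* ring of the M_n, n > 0, whose piece of degree n is hecke_part n below.     *)
Definition hecke_ring : Type := malg pmx rat.

HB.instance Definition _ := GRing.Lmodule.on hecke_ring.

Definition hbase (g : pmx) : hecke_ring := mkmalgU g 1.

Definition hmul (u v : hecke_ring) : hecke_ring :=
  \sum_(g <- msupp u) \sum_(h <- msupp v)
    (mcoeff g u * mcoeff h v) *: hbase (pmul g h).

Lemma hmul_base (g h : pmx) : hmul (hbase g) (hbase h) = hbase (pmul g h).
Proof.
have msuppU k : msupp (hbase k) = [fset k]%fset.
  by rewrite /hbase msuppU oner_eq0.
by rewrite /hmul !msuppU !big_seq_fset1 /hbase !mcoeffUU mulr1 scale1r.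
Qed.

Definition hecke_part (n : nat) (u : hecke_ring) : Prop :=
  forall g : pmx, g \in msupp u -> pdet g = n%:Z.

Definition h1 : hecke_ring := hbase (pm (mx2 1 0 0 1)).
Definition hS : hecke_ring := hbase (pm (mx2 0 (-1) 1 0)).
Definition hT : hecke_ring := hbase (pm (mx2 1 1 0 1)).

Definition hecke_infty (n : nat) : hecke_ring :=
  \sum_(d <- divisors n) \sum_(b < d)
    hbase (pm (mx2 (n %/ d)%N%:Z (b : nat)%:Z 0 d%:Z)).

Definition hecke_on_periods (n : nat) (u : hecke_ring) : Prop :=
  exists2 Y : hecke_ring, hecke_part n Y &
    hmul (h1 - hS) u = hmul (hecke_infty n) (h1 - hS) + hmul (h1 - hT) Y.

Definition has_nonneg_repr (g : pmx) : Prop :=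
  exists2 m : 'M[int]_2, pm m = g & forall i j, 0 <= m i j.

End HeckeRing.

Section Analysis.
Context {R : realType}.
Implicit Types (x : R) (g : pmx).

Definition Gamma x : R :=
  \int[lebesgue_measure]_(t in `]0, +oo[) (t `^ (x - 1) * expR (- t)).

Definition digamma x : R := derive1 Gamma x / Gamma x.

(* The Herglotz function and its modification, on the positive half-line. *)
Definition herglotz x : R :=
  limn (series (fun k => (digamma (k.+1%:R * x) - ln (k.+1%:R * x)) / k.+1%:R)).

Definition mod_herglotz x : R :=
  herglotz x - herglotz 1 + pi ^+ 2 / 12 * (x - 2 + x^-1) - ln x ^+ 2 / 4.

Definition dilog x : R := limn (series (fun k => x ^+ k.+1 / k.+1%:R ^+ 2)).

Definition rogersL01 x : R :=
  if x == 0 then 0 else if x == 1 then pi ^+ 2 / 6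
  else dilog x + ln x * ln (1 - x) / 2.

Definition rogersL x : R :=
  if x < 0 then - rogersL01 (x / (x - 1))
  else if 1 < x then pi ^+ 2 / 3 - rogersL01 x^-1
  else rogersL01 x.

Definition mobius_mx (m : 'M[int]_2) x : R :=
  ((m 0 0)%:~R * x + (m 0 1)%:~R) / ((m 1 0)%:~R * x + (m 1 1)%:~R).

Definition mobius g x : R := mobius_mx (repr g) x.

Definition fixes_infty g : bool := repr g 1 0 == 0.

(* Meaningful only when [~~ fixes_infty g]. *)
Definition mobius_infty g : R := (repr g 0 0)%:~R / (repr g 1 0)%:~R.

Lemma mobiusE (m : 'M[int]_2) x : mobius (pm m) x = mobius_mx m x.
Proof.
rewrite /mobius; case: (repr_pm m) => -> //.
by rewrite /mobius_mx !mxE !mulrNz !mulNr -!opprD invrN mulrNN.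
Qed.

Lemma fixes_inftyE (m : 'M[int]_2) : fixes_infty (pm m) = (m 1 0 == 0).
Proof.
by rewrite /fixes_infty; case: (repr_pm m) => ->; rewrite ?mxE ?oppr_eq0.
Qed.

Lemma mobius_inftyE (m : 'M[int]_2) :
  mobius_infty (pm m) = (m 0 0)%:~R / (m 1 0)%:~R.
Proof.
rewrite /mobius_infty; case: (repr_pm m) => -> //.
by rewrite !mxE !mulrNz invrN mulrNN.
Qed.

Definition slash0 (f : R -> R) (u : hecke_ring) x : R :=
  \sum_(g <- msupp u) ratr (mcoeff g u) * f (mobius g x).

Definition sigma (n : nat) : R := \sum_(d <- divisors n) d%:R.

Definition hecke_logcoef (n : nat) : R :=
  2^-1 * \sum_(l <- divisors n) l%:R * ln (l%:R ^+ 2 / n%:R).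

End Analysis.

(* Main.v *)
(** Differentiate in [x > 0]: since only some constant [K] is claimed, it is
    enough to identify derivatives.  Writing [w1 = a x + b], [w2 = c x + d] for
    a matrix [[a b; c d]] of determinant [n], the derivative of [F] composed
    with the matrix is

      n * int_0^oo (t / ((e^(t w1) - 1) (1 - e^(- t w2))) - 1 / (w2 (e^(t w1) - 1))) dt,

    because [psi y - log y = - int_0^oo (1 / (1 - e^-t) - 1 / t) e^(- y t) dt].
    The first term of the integrand is [t] times the generating function
    [\sum e^(- t (u x + v))] of the lattice points [(u, v)] in the half-open
    cone spanned by the rows of the matrix.

    The relation [(1 - S) T_n = T_n^oo (1 - S) + (1 - T) Y] says that
    [\sum nu (P(gamma) - P(S gamma))] can be computed on [T_n^oo] for every
    function [P] of matrices modulo sign which is invariant under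
    [gamma |-> T gamma], i.e. which depends only on the lattice spanned by the
    rows and on the second row.  Applied to the indicator function of [(u, v)]
    being in the lattice and below the second row, it shows that the cones of
    the [gamma], weighted by [nu], cover each [(u, v)] with [u > 0] exactly
    [\sum_(l | gcd(u, v, n)) l] times, hence the generating functions add up to
    those of [sigma(n) F'].  What is left is the integral of a combination of
    the functions [1 / (e^(al t) - 1)], which is elementary and consists of
    logarithms; these match the derivatives of the Rogers dilogarithms and of
    [A_n log x] by the same relation applied to three explicit functions of
    the second row. *)
Require Import Defs.
From mathcomp Require Import all_boot all_order all_algebra.
From mathcomp Require Import all_classical all_reals all_analysis.
From mathcomp Require Import finmap.
From mathcomp Require Import -(notations) monalg.
From mathcomp Require Import measurable_realfun.
From mathcomp Require Import zify ring lra.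

Set Implicit Arguments.
Unset Strict Implicit.
Unset Printing Implicit Defensive.

Import Order.TTheory GRing.Theory Num.Theory.
Import numFieldNormedType.Exports.

Local Open Scope classical_set_scope.
Local Open Scope ring_scope.

(** * Linear functionals on formal combinations of matrices, and the Hecke relation *)

Section HeckePairing.
Context {R : realType}.
Implicit Types (h : pmx -> R) (P : 'M[int]_2 -> R) (u v : hecke_ring).

(** The linear extension of [h] to formal combinations; for instance [slash0 f u x] is the pairing
    of [u] with [g |-> f (mobius g x)]. *)
Definition hpair h u : R := mmap (@ratr R) h u.

Lemma hpairE h u : hpair h u = \sum_(g <- msupp u) ratr (mcoeff g u) * h g.
Proof. by []. Qed.

Lemma hpair0 h : hpair h 0 = 0. Proof. exact: mmap0. Qed.

Lemma hpairD h : {morph hpair h : u v / u + v}. Proof. exact: mmapD. Qed.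

Lemma hpairN h : {morph hpair h : u / - u}. Proof. exact: mmapN. Qed.

Lemma hpair_base h g : hpair h (hbase g) = h g.
Proof. by rewrite /hpair /hbase mmapU /=  (rmorph1 (@ratr R)) mul1r. Qed.

Lemma hpair_scale_base h c g : hpair h (c *: hbase g) = ratr c * h g.
Proof.
by rewrite /hpair (mmapEw (msuppZ_le _ _)) /hbase msuppU oner_eq0
  big_seq_fset1 mcoeffZ mcoeffUU mulr1.
Qed.

Lemma hpair_sum h (I : Type) (r : seq I) (F : I -> hecke_ring) :
  hpair h (\sum_(i <- r) F i) = \sum_(i <- r) hpair h (F i).
Proof. by elim/big_rec2: _ => [|i x y _ <-]; rewrite ?hpair0 ?hpairD. Qed.

Lemma hpair_mul h u v :
  hpair h (hmul u v) = hpair (fun g => hpair (fun k => h (pmul g k)) v) u.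
Proof.
rewrite /hmul hpair_sum [RHS]hpairE; apply: eq_bigr => g _.
rewrite hpair_sum [in RHS]hpairE mulr_sumr; apply: eq_bigr => k _.
by rewrite hpair_scale_base rmorphM mulrA.
Qed.

Lemma eq_hpair h h' u : (forall g, g \in msupp u -> h g = h' g) ->
  hpair h u = hpair h' u.
Proof.
move=> hh'; rewrite !hpairE; apply: eq_big_seq => g gu.
by rewrite hh'.
Qed.

Lemma hpairB h h' u : hpair h u - hpair h' u = hpair (fun g => h g - h' g) u.
Proof.
by rewrite !hpairE -sumrB; apply: eq_bigr => g _; rewrite mulrBr.
Qed.

Lemma mulSmx (a b c d : int) :
  mx2 0 (-1) 1 0 *m mx2 a b c d = mx2 (- c) (- d) a b.
Proof.
apply/matrixP => i j; rewrite !mxE !big_ord_recl big_ord0 !mxE /=.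
by case: i => [[|[|//]]] ?; case: j => [[|[|//]]] ? /=; lia.
Qed.

Lemma mulTmx (a b c d : int) :
  mx2 1 1 0 1 *m mx2 a b c d = mx2 (a + c) (b + d) c d.
Proof.
apply/matrixP => i j; rewrite !mxE !big_ord_recl big_ord0 !mxE /=.
by case: i => [[|[|//]]] ?; case: j => [[|[|//]]] ? /=; lia.
Qed.

Lemma mulmxS (a b c d : int) :
  mx2 a b c d *m mx2 0 (-1) 1 0 = mx2 b (- a) d (- c).
Proof.
apply/matrixP => i j; rewrite !mxE !big_ord_recl big_ord0 !mxE /=.
by case: i => [[|[|//]]] ?; case: j => [[|[|//]]] ? /=; lia.
Qed.

Lemma mul1mx2 (a b c d : int) : mx2 1 0 0 1 *m mx2 a b c d = mx2 a b c d.
Proof.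
apply/matrixP => i j; rewrite !mxE !big_ord_recl big_ord0 !mxE /=.
by case: i => [[|[|//]]] ?; case: j => [[|[|//]]] ? /=; lia.
Qed.

Lemma mulmx21 (a b c d : int) : mx2 a b c d *m mx2 1 0 0 1 = mx2 a b c d.
Proof.
apply/matrixP => i j; rewrite !mxE !big_ord_recl big_ord0 !mxE /=.
by case: i => [[|[|//]]] ?; case: j => [[|[|//]]] ? /=; lia.
Qed.

Lemma mx2E (m : 'M[int]_2) : m = mx2 (m 0 0) (m 0 1) (m 1 0) (m 1 1).
Proof.
apply/matrixP => i j; rewrite !mxE.
by case: i => [[|[|//]]] ?; case: j => [[|[|//]]] ? /=;
  congr (m _ _); apply: val_inj.
Qed.

Lemma oppmx2 (a b c d : int) : - mx2 a b c d = mx2 (- a) (- b) (- c) (- d).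
Proof.
apply/matrixP => i j; rewrite !mxE.
by case: (_ == _); case: (_ == _).
Qed.

Lemma det_mx2 (a b c d : int) : \det (mx2 a b c d) = a * d - b * c.
Proof.
rewrite (expand_det_row _ 0) !big_ord_recl big_ord0 /cofactor !det_mx11 !mxE /=.
by rewrite addr0 expr0 mul1r expr1 mulN1r mulrN.
Qed.

Lemma pmx_ind (P : pmx -> Prop) :
  (forall a b c d : int, P (pm (mx2 a b c d))) -> forall g, P g.
Proof. by move=> H g; rewrite -[g]reprK [repr g]mx2E; exact: H. Qed.

(* A function of matrices that does not change under [g |-> - g] and *)
(* [g |-> T g] kills [(1 - T) Y]. *)
Lemma hecke_on_periods_pairing n (u : hecke_ring)
    (P : int -> int -> int -> int -> R) :
  hecke_on_periods n u ->
  (forall a b c d : int, P (- a) (- b) (- c) (- d) = P a b c d) ->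
  (forall a b c d : int, P (a + c) (b + d) c d = P a b c d) ->
  let PM (m : 'M[int]_2) := P (m 0 0) (m 0 1) (m 1 0) (m 1 1) in
  let PS (m : 'M[int]_2) := P (- m 1 0) (- m 1 1) (m 0 0) (m 0 1) in
  hpair (fun g : pmx => PM (repr g) - PS (repr g)) u =
  \sum_(d <- divisors n) \sum_(b < d)
    (P (n %/ d)%N%:Z (b : nat)%:Z 0 d%:Z -
     P (b : nat)%:Z (- (n %/ d)%N%:Z) d%:Z 0).
Proof.
move=> [Y _ eqY] PN PT PM PS.
(* [PN] makes the value of [h] independent of the sign chosen by [repr]. *)
pose h (g : pmx) := PM (repr g).
have hE a b c d : h (pm (mx2 a b c d)) = P a b c d.
  rewrite /h /PM; case: (repr_pm (mx2 a b c d)) => ->.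
    by rewrite !mxE.
  by rewrite oppmx2 !mxE /= PN.
have := congr1 (hpair h) eqY.
rewrite hpairD !hpair_mul.
have hpair1B (k : pmx -> R) (w : hecke_ring) :
    hpair k (h1 - w) = k (pm (mx2 1 0 0 1)) - hpair k w.
  by rewrite hpairD hpairN hpair_base.
rewrite !hpair1B !hpair_base !hpairB => e.
transitivity (hpair (fun g =>
  h (pmul (pm (mx2 1 0 0 1)) g) - h (pmul (pm (mx2 0 (-1) 1 0)) g)) u).
  apply: eq_hpair => g _; elim/pmx_ind: g => a b c d.
  rewrite !pmulE mul1mx2 mulSmx !hE /PM /PS.
  case: (repr_pm (mx2 a b c d)) => ->; rewrite ?oppmx2 !mxE //=.
  rewrite PN; congr (_ - _).
  by rewrite PN.
(* The contribution of [Y] vanishes by [PT], since left multiplication by [T] adds the second row to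
   the first. *)
rewrite {}e [X in _ + X](_ : _ = 0) ?addr0; last first.
  rewrite -[RHS](_ : hpair (fun=> 0) Y = 0); last first.
    by rewrite hpairE big1 // => g _; rewrite mulr0.
  apply: eq_hpair => g _; elim/pmx_ind: g => a b c d.
  by rewrite !pmulE mul1mx2 mulTmx !hE PT subrr.
rewrite /hecke_infty hpair_sum; apply: eq_bigr => d _.
rewrite hpair_sum; apply: eq_bigr => b _.
by rewrite hpair_base hpair1B hpair_base !pmulE mulmx21 mulmxS !hE oppr0.
Qed.

End HeckePairing.

(** * Divisor sums and linear congruences *)

Section DivisorSums.

Lemma perm_divisors_div n : (0 < n)%N ->
  perm_eq [seq (n %/ d)%N | d <- divisors n] (divisors n).
Proof.
move=> n0; apply: uniq_perm; rewrite ?divisors_uniq //.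
  rewrite map_inj_in_uniq ?divisors_uniq // => d e.
  rewrite -!dvdn_divisors // => dn en H.
  by rewrite -[d](mulKn _ n0) -[e](mulKn _ n0) -!divnA // H.
move=> k; apply/mapP/idP => [[d]|].
  by rewrite -!dvdn_divisors // => dn ->; exact: dvdn_div.
rewrite -dvdn_divisors // => kn; exists (n %/ k)%N.
  by rewrite -dvdn_divisors //; exact: dvdn_div.
by rewrite divnA // mulKn.
Qed.

Lemma sum_divisors_div (V : nmodType) n (f : nat -> V) : (0 < n)%N ->
  \sum_(d <- divisors n) f (n %/ d)%N = \sum_(d <- divisors n) f d.
Proof.
by move=> n0; rewrite -[RHS](perm_big _ (perm_divisors_div n0)) /= big_map.
Qed.

Lemma sum_divisors_dvd (V : nmodType) n u (f : nat -> V) : (0 < n)%N ->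
  \sum_(d <- divisors n | (d %| u)%N) f d =
  \sum_(d <- divisors (gcdn u n)) f d.
Proof.
move=> n0; rewrite -big_filter; apply: perm_big; apply: uniq_perm.
- by rewrite filter_uniq // divisors_uniq.
- exact: divisors_uniq.
move=> k; rewrite mem_filter -!dvdn_divisors //.
  by rewrite dvdn_gcd.
by rewrite gcdn_gt0 n0 orbT.
Qed.

(** Multiplication by a unit permutes the residues modulo [d], so exactly one [b] solves the
    congruence. *)
Lemma sum_modn_coprime i d v : (0 < d)%N -> coprime i d ->
  (\sum_(b < d) (i * b == v %[mod d]) = 1)%N.
Proof.
case: d => // d _ cid.
pose f (b : 'I_d.+1) : 'I_d.+1 := inord ((i * b) %% d.+1).
have fE b : f b = (i * b %% d.+1)%N :> nat by rewrite inordK // ltn_mod.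
have finj : injective f.
  move=> b c /(congr1 val) /=; rewrite !fE => /eqP H; apply: val_inj => /=.
  wlog bc : b c H / (b <= c)%N.
    move=> W; case: (leqP b c) => [|/ltnW] bc; first exact: W.
    by apply/esym/W; rewrite // eq_sym.
  move: H; rewrite eq_sym eqn_mod_dvd ?leq_mul // -mulnBr.
  rewrite Gauss_dvdr; last by rewrite coprime_sym.
  case: (posnP (c - b)%N) => [|lt]; first by lia.
  by move=> /(dvdn_leq lt); have := ltn_ord c; lia.
pose w : 'I_d.+1 := inord (v %% d.+1).
have wE : w = (v %% d.+1)%N :> nat by rewrite inordK // ltn_mod.
transitivity (\sum_(b < d.+1) (f b == w : nat))%N.
  by apply: eq_bigr => b _; rewrite -(inj_eq val_inj) /= fE wE.
rewrite -(@reindex_inj _ _ _ _ _ xpredT (fun c => (c == w : nat)) finj) /=.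
rewrite (bigD1 w) //= eqxx big1 // => c /negbTE -> //.
Qed.

Lemma sum_periodic (F : nat -> nat) d k :
  (forall b, F (b + d)%N = F b) ->
  (\sum_(0 <= b < k * d) F b = k * \sum_(0 <= b < d) F b)%N.
Proof.
move=> Fd; elim: k => [|k IH]; first by rewrite !mul0n big_nil.
have FdM m b : F (b + m * d)%N = F b.
  by elim: m => [|m IHm]; rewrite ?mul0n ?addn0 // mulSn addnCA addnC Fd IHm.
rewrite (@big_cat_nat _ _ _ (k * d)) //= ?IH; last by rewrite mulSn leq_addl.
rewrite [X in (_ + X)%N](_ : _ = \sum_(0 <= b < d) F b)%N; first by lia.
rewrite -[X in (\sum_(X <= _ < _) _)%N]add0n big_addn mulSn addnK.
by apply: eq_bigr => b _; rewrite FdM.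
Qed.

(** A solution forces [g = gcdn i d] to divide [v]. Dividing by [g] then leaves a unit coefficient
    modulo [d / g], and the unique solution there lifts to [g] residues modulo [d]. *)
Lemma sum_modn_gcd i d v : (0 < d)%N ->
  (\sum_(b < d) (i * b == v %[mod d]) = gcdn i d * (gcdn i d %| v))%N.
Proof.
move=> d0; set g := gcdn i d.
have g0 : (0 < g)%N by rewrite gcdn_gt0 d0 orbT.
have [i' iE] := dvdnP (dvdn_gcdl i d); have [d' dE] := dvdnP (dvdn_gcdr i d).
rewrite -/g in iE dE.
have d'0 : (0 < d')%N by move: d0; rewrite dE; case: d' {dE}.
have cop : coprime i' d'.
  move: (erefl g); rewrite {1}/g {1}iE {1}dE -muln_gcdl /coprime.
  by move/(congr1 (fun m => m %/ g)%N); rewrite mulnK // divnn g0 => ->.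
case: (boolP (g %| v)%N) => [/dvdnP[v' vE]|gv]; last first.
  rewrite muln0 big1 // => b _; apply/eqP; rewrite eqb0.
  apply: contra gv => /eqP H.
  have : (g %| i * b %% d)%N.
    by rewrite /dvdn modn_dvdm ?dvdn_gcdr // -/(dvdn g _) dvdn_mulr ?dvdn_gcdl.
  by rewrite H /dvdn modn_dvdm ?dvdn_gcdr.
rewrite muln1.
have E b : (i * b == v %[mod d])%N = (i' * b == v' %[mod d'])%N.
  rewrite iE vE dE -mulnA (mulnC g b) mulnA -!muln_modl.
  by rewrite eqn_pmul2r.
transitivity (\sum_(0 <= b < g * d') (i' * b == v' %[mod d'] : nat))%N.
  by rewrite big_mkord (mulnC g) -dE; apply: eq_bigr => b _; rewrite E.
rewrite sum_periodic; last by move=> b; rewrite mulnDr addnC modnMDl.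
by rewrite big_mkord sum_modn_coprime // muln1.
Qed.

End DivisorSums.

(** * Lattice points in the cones spanned by matrix rows *)

Section Cones.
Context {R : realType}.

(* [(u, v)] lies in the lattice spanned by the rows of [[a b; c d]], of *)
(* determinant [n], and strictly below the ray spanned by [(|c|, |d|)]. *)
Definition below_ray (n u v : nat) (a b c d : int) : bool :=
  [&& (n%:Z %| u%:Z * d - v%:Z * c)%Z, (n%:Z %| v%:Z * a - u%:Z * b)%Z
    & v%:Z * `|c| < u%:Z * `|d|].

Lemma below_rayN n u v (a b c d : int) :
  below_ray n u v (- a) (- b) (- c) (- d) = below_ray n u v a b c d.
Proof.
by rewrite /below_ray !normrN !mulrN -!opprD !rpredN.
Qed.

(** Adding the second row to the first changes neither the row lattice nor the second row. *)
Lemma below_rayT n u v (a b c d : int) :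
  below_ray n u v (a + c) (b + d) c d = below_ray n u v a b c d.
Proof.
rewrite /below_ray; case H : (n%:Z %| u%:Z * d - v%:Z * c)%Z => //=.
congr (_ && _).
rewrite (_ : _ - _ = (v%:Z * a - u%:Z * b) - (u%:Z * d - v%:Z * c)); last by ring.
by rewrite rpredBr.
Qed.

(** By Cramer's rule, for a matrix of determinant [n] the integers [(u d - v c) / n] and
    [(v a - u b) / n] are the coordinates of [(u, v)] along the two rows. The first is positive and
    the second nonnegative: the cone contains the ray of its first row, without the origin, but not
    that of its second row. *)
Definition in_cone (n u v : nat) (a b c d : int) : bool :=
  [&& (n%:Z %| u%:Z * d - v%:Z * c)%Z, (n%:Z %| v%:Z * a - u%:Z * b)%Z,
      v%:Z * c < u%:Z * d & u%:Z * b <= v%:Z * a].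

(** The second row of [S gamma] is the first row of [gamma], and both span the same lattice. As the
    determinant is positive, the first row has the smaller slope, so the difference counts the
    points below the second row but not below the first. *)
Lemma below_rayB n u v (a b c d : int) : (0 < n)%N ->
  0 <= a -> 0 <= b -> 0 <= c -> 0 <= d -> a * d - b * c = n%:Z ->
  (below_ray n u v a b c d)%:R - (below_ray n u v (- c) (- d) a b)%:R
  = (in_cone n u v a b c d)%:R :> R.
Proof.
move=> n0 a0 b0 c0 d0 det.
rewrite /below_ray /in_cone !ger0_norm //.
rewrite (_ : v%:Z * (- c) - u%:Z * (- d) = u%:Z * d - v%:Z * c); last by ring.
rewrite (_ : u%:Z * b - v%:Z * a = - (v%:Z * a - u%:Z * b)); last by ring.
rewrite rpredN.
case: (n%:Z %| u%:Z * d - v%:Z * c)%Z; rewrite ?andbF /= ?subrr //.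
case: (n%:Z %| v%:Z * a - u%:Z * b)%Z; rewrite /= ?subrr //.
case: (leP (u%:Z * b) (v%:Z * a)) => h1; case: (ltP (v%:Z * c) (u%:Z * d)) => h2;
  rewrite ?subr0 ?subrr //.
(* The remaining case, below the first row but not below the second, would make the left side
   positive and the right side at most zero. *)
have : u%:Z * n%:Z + c * (u%:Z * b - v%:Z * a) = a * (u%:Z * d - v%:Z * c).
  by rewrite -det; ring.
have : 0 < u%:Z.
  rewrite lt0r; apply/andP; split=> //; apply/eqP => u00.
  by move: h1; rewrite u00 mul0r ltNge mulr_ge0.
by nia.
Qed.

Lemma in_coneP n u v (a b c d : nat) : (0 < n)%N -> (a * d = b * c + n)%N ->
  reflect (exists i j : nat,
    [/\ (0 < i)%N, u = (i * a + j * c)%N & v = (i * b + j * d)%N])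
  (in_cone n u v a b c d).
Proof.
move=> n0 det; apply: (iffP and4P).
  move=> [/dvdzP[i iE] /dvdzP[j jE] h1 h2].
  have i0 : 0 < i by nia.
  have j0 : 0 <= j by nia.
  exists `|i|%N, `|j|%N; split; first by lia.
    suff : u%:Z * n%:Z = (i * a%:Z + j * c%:Z) * n%:Z by nia.
    by rewrite mulrDl mulrAC -iE mulrAC -jE; nia.
  suff : v%:Z * n%:Z = (i * b%:Z + j * d%:Z) * n%:Z by nia.
  by rewrite mulrDl mulrAC -iE mulrAC -jE; nia.
move=> [i [j [i0 -> ->]]]; split.
- by apply/dvdzP; exists i%:Z; nia.
- by apply/dvdzP; exists j%:Z; nia.
- by nia.
- by nia.
Qed.

(** Nothing lies below the second row [(d, 0)] of the other matrix. With [a = n / d], the first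
    indicator says that [a] divides [u] and [(u / a) b = v] modulo [d], so the sum over [b] is
    [gcd(u / a, d)] if this divides [v], and zero otherwise. Since
    [gcd(u / a, n / a) = gcd(u, n) / a], the substitution [l = gcd(u, n) / a] gives the right side,
    where the cone condition means that [u > 0] and [l] divides [u] and [v]. *)
Lemma sum_below_ray n u v : (0 < n)%N ->
  \sum_(d <- divisors n) \sum_(b < d)
    ((below_ray n u v (n %/ d)%N%:Z (b : nat)%:Z 0 d%:Z)%:R -
     (below_ray n u v (b : nat)%:Z (- (n %/ d)%N%:Z) d%:Z 0)%:R) =
  \sum_(l <- divisors n) l%:R * (in_cone (l ^ 2) u v l 0 0 l)%:R :> R.
Proof.
move=> n0.
have [u0|u0] := posnP u.
  rewrite u0 !big1_seq // => d /andP[_]; rewrite -dvdn_divisors // => dn.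
    by rewrite /in_cone mul0r mulr0 ltxx !andbF mulr0.
  rewrite big1 // => b _; rewrite /below_ray !mul0r normr0 mulr0 !ltxx !andbF.
  by rewrite subrr.
have inE l : (0 < l)%N ->
    in_cone (l ^ 2) u v l 0 0 l = (l %| u)%N && (l %| v)%N.
  move=> l0; rewrite /in_cone !mulr0 !subr0 expnS expn1.
  rewrite mulr_gt0 ?ltz_nat // mulr_ge0 // !andbT.
  by rewrite -!PoszM !dvdzE !absz_nat !dvdn_pmul2r.
transitivity (\sum_(d <- divisors n | ((n %/ d) %| u)%N)
    (gcdn (u %/ (n %/ d)) d * (gcdn (u %/ (n %/ d)) d %| v))%:R : R).
  rewrite [RHS]big_mkcond; apply: eq_big_seq => d.
  rewrite -dvdn_divisors // => dn.
  have d0 : (0 < d)%N by apply: dvdn_gt0 dn.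
  have nE : n = (n %/ d * d)%N by rewrite divnK.
  set a := (n %/ d)%N in nE *.
  have a0 : (0 < a)%N by case: (a) nE => // H; move: n0; rewrite {1}H.
  have E (b : nat) : (below_ray n u v a b 0 d)%:R -
      (below_ray n u v b (- a%:Z) d%:Z 0)%:R
      = ((a %| u) && ((u %/ a) * b == v %[mod d]))%N%:R :> R.
    have -> : below_ray n u v b (- a%:Z) d%:Z 0 = false.
      by rewrite /below_ray normr0 mulr0 !andbF.
    rewrite subr0 /below_ray normr0 mulr0 subr0.
    rewrite mulr_gt0 ?ltz_nat ?normr_gt0 ?eqz_nat -?lt0n // andbT.
    congr ((nat_of_bool _) %:R); rewrite {1 2}nE.
    rewrite -[in X in X && _]PoszM [X in X && _]dvdzE !absz_nat.
    rewrite dvdn_pmul2r //; case: (boolP (a %| u)%N) => //= au.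
    rewrite -[X in X%:Z * b%:Z](divnK au).
    rewrite (_ : _ - _ = (v%:Z - (u %/ a * b)%N%:Z) * a%:Z); last by lia.
    rewrite (_ : (a * d)%N%:Z = d%:Z * a%:Z); last by lia.
    rewrite dvdz_mul2r ?eqz_nat -?lt0n //.
    rewrite -eqz_mod_dvd eq_sym.
    by rewrite !modz_nat eqz_nat.
  under eq_bigr do rewrite E.
  case: ifP => au; last by rewrite big1.
  by rewrite -(@sum_modn_gcd _ d v d0) natr_sum; apply: eq_bigr => b _.
pose f a := (gcdn (u %/ a) (n %/ a) * (gcdn (u %/ a) (n %/ a) %| v))%N.
transitivity (\sum_(a <- divisors n | (a %| u)%N) (f a)%:R : R).
  rewrite big_mkcond [RHS]big_mkcond /=.
  rewrite -(sum_divisors_div (fun a => if (a %| u)%N then (f a)%:R else 0 : R)) //.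
  apply: eq_big_seq => d; rewrite -dvdn_divisors // => dn.
  have nnd : (n %/ (n %/ d) = d)%N by rewrite divnA // mulKn.
  by rewrite /f nnd.
rewrite (sum_divisors_dvd _ (fun a => (f a)%:R)) //.
have G0 : (0 < gcdn u n)%N by rewrite gcdn_gt0 u0.
transitivity (\sum_(a <- divisors (gcdn u n))
   ((gcdn u n %/ a) * (gcdn u n %/ a %| v))%N%:R : R).
  apply: eq_big_seq => a; rewrite -dvdn_divisors // dvdn_gcd => /andP[au an].
  have a0 : (0 < a)%N by apply: dvdn_gt0 an.
  have -> : (gcdn u n %/ a = gcdn (u %/ a) (n %/ a))%N.
    by rewrite -{1}(divnK au) -{1}(divnK an) -muln_gcdl mulnK.
  by [].
rewrite (sum_divisors_div (fun l => (l * (l %| v))%N%:R)) //.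
rewrite -(sum_divisors_dvd _ (fun l => (l * (l %| v))%N%:R)) //.
rewrite big_mkcond; apply: eq_big_seq => l; rewrite -dvdn_divisors // => ln.
rewrite inE; last by apply: dvdn_gt0 ln.
by case: (l %| u)%N; rewrite ?mulr0 // natrM.
Qed.

End Cones.

(** * Linear relations between sums of nonnegative families *)

Section LinearEsum.
Context {R : realType}.

Lemma esumZl (T : choiceType) (S : set T) (a : T -> \bar R) (r : R) : 0 <= r ->
  (forall i, 0 <= a i)%E ->
  (\esum_(i in S) (r%:E * a i) = r%:E * \esum_(i in S) a i)%E.
Proof.
move=> r0 a0; rewrite /esum -ereal_supZl //; last first.
  apply/set0P; exists (\sum_(x \in (set0 : set T)) a x)%E => /=.
  by exists set0 => //; split.
congr ereal_sup; apply/seteqP; split => y /=.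
  move=> [A SA <-]; exists (\sum_(x \in A) a x)%E; first by exists A.
  by rewrite ge0_mule_fsumr.
by move=> [_ [A SA <-] <-]; exists A => //; rewrite ge0_mule_fsumr.
Qed.

Lemma nneseries_geometric (a z : R) : 0 <= z -> z < 1 ->
  (\sum_(0 <= k <oo) (a * z ^+ k)%:E = (a / (1 - z))%:E)%E.
Proof.
move=> z0 z1; apply/cvg_lim => //.
under eq_fun do rewrite sumEFin.
apply: cvg_EFin; first exact: nearW.
by apply: cvg_geometric_series; rewrite ger0_norm.
Qed.

(** Extended nonnegative sums cannot be subtracted, so the coefficients are split into positive and
    negative parts. The pointwise relation equates the two resulting families, whose sums are finite
    and hence can be compared in [R]. *)
Lemma esum_lincomb (T I : choiceType) (s : seq I) (c : I -> R)
    (f : I -> T -> R) (S : I -> R) :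
  (forall i p, 0 <= f i p) ->
  (forall i, i \in s -> (\esum_(p in [set: T]) (f i p)%:E = (S i)%:E)%E) ->
  (forall p, \sum_(i <- s) c i * f i p = 0) ->
  \sum_(i <- s) c i * S i = 0.
Proof.
move=> f0 fS cf.
pose cp i := Num.max (c i) 0; pose cm i := Num.max (- c i) 0.
have cE i : c i = cp i - cm i.
  rewrite /cp /cm; have [ci|ci] := leP 0 (c i).
    by rewrite [X in _ - X]max_r ?oppr_le0 // subr0.
  by rewrite [X in _ - X]max_l ?oppr_ge0 ?(ltW ci) // sub0r opprK.
have cp0 i : 0 <= cp i by rewrite le_max lexx orbT.
have cm0 i : 0 <= cm i by rewrite le_max lexx orbT.
have key (e : I -> R) : (forall i, 0 <= e i) ->
    (\esum_(p in [set: T]) (\sum_(i <- s) e i * f i p)%:E =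
     (\sum_(i <- s) e i * S i)%:E)%E.
  move=> e0; under eq_esum do rewrite -sumEFin.
  rewrite esum_sum; last by move=> *; rewrite lee_fin mulr_ge0.
  rewrite -sumEFin; apply: eq_big_seq => i si.
  under eq_esum do rewrite EFinM.
  by rewrite esumZl // ?fS // => p; rewrite lee_fin.
have : (\sum_(i <- s) cp i * S i)%:E = (\sum_(i <- s) cm i * S i)%:E.
  rewrite -!key //; apply: eq_esum => p _; congr _%:E.
  apply/eqP; rewrite -subr_eq0 -sumrB; apply/eqP; rewrite -[RHS](cf p).
  by apply: eq_bigr => i _; rewrite -mulrBl -cE.
move=> [H]; under eq_bigr do rewrite cE mulrBl.
by rewrite sumrB H subrr.
Qed.

End LinearEsum.

(** * Generating functions of the cones *)

Section ConeGeneratingFunction.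
Context {R : realType}.

(** For positive [al] and [be], the closed form of the sum of [e^(- i al - j be)] over [i >= 1] and
    [j >= 0]. *)
Definition conegen (al be : R) : R := (expR al - 1)^-1 / (1 - expR (- be)).

(** In the coordinates of [in_coneP] the sum is a product of two geometric series. *)
Lemma esum_cone n (a b c d : nat) (x t : R) :
  (0 < n)%N -> (a * d = b * c + n)%N -> 0 < x -> 0 < t ->
  (\esum_(p in [set: (nat * nat)%type])
     ((in_cone n p.1 p.2 a b c d)%:R * expR (- (t * (p.1%:R * x + p.2%:R))))%:E =
   (conegen (t * (a%:R * x + b%:R)) (t * (c%:R * x + d%:R)))%:E)%E.
Proof.
move=> n0 det x0 t0.
have a0 : (0 < a)%N by nia.
have d0 : (0 < d)%N by nia.
set al := t * _; set be := t * _.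
have al0 : 0 < al by rewrite mulr_gt0 // ltr_wpDr // mulr_gt0 // ltr0n.
have be0 : 0 < be by rewrite mulr_gt0 // ltr_wpDl ?ltr0n // mulr_ge0 // ltW.
(* The successor encodes that the coordinate along the first row is positive; [e] is injective
   because the determinant is not zero. *)
pose e (k : nat * nat) := (k.1.+1 * a + k.2 * c, k.1.+1 * b + k.2 * d)%N.
have einj : set_inj [set: (nat * nat)%type] e.
  move=> [i j] [i' j'] _ _ [H1 H2].
  have [] : (i%:Z - i'%:Z) * n%:Z = 0 /\ (j%:Z - j'%:Z) * n%:Z = 0 by nia.
  by move=> /eqP; rewrite mulf_eq0 => /orP[|/eqP]; last lia;
     move=> ? /eqP; rewrite mulf_eq0 => /orP[|/eqP]; last lia;
     move=> ?; congr pair; lia.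
transitivity (\esum_(p in e @` [set: (nat * nat)%type])
    (expR (- (t * (p.1%:R * x + p.2%:R))))%:E)%E.
  rewrite [RHS]esum_mkcond; apply: eq_esum => -[u v] _ /=.
  case: in_coneP => //= [[i [j [i0 -> ->]]]|H].
    rewrite mem_set /= ?mul1r //; exists (i.-1, j) => //.
    by rewrite /e /= prednK.
  rewrite memNset /= ?mul0r // => -[[i j] _ [uE vE]]; apply: H.
  by exists i.+1, j.
rewrite esum_image //.
pose q1 := expR (- al); pose q2 := expR (- be).
have q1B : 0 <= q1 < 1 by rewrite expR_ge0 expR_lt1 oppr_lt0.
have q2B : 0 <= q2 < 1 by rewrite expR_ge0 expR_lt1 oppr_lt0.
have E (k : nat * nat) :
    expR (- (t * ((e k).1%:R * x + (e k).2%:R))) = q1 * q1 ^+ k.1 * q2 ^+ k.2.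
  rewrite -exprS /q1 /q2 -!expRM_natl -expRD; congr expR.
  rewrite /al /be /e /= !natrD !natrM; ring.
under eq_esum do rewrite E.
rewrite (_ : [set: nat * nat] = [set: nat] `*`` (fun=> [set: nat])); last first.
  by apply/seteqP; split.
rewrite -(@esum_esum _ _ _ _ _ (fun i j => (q1 * q1 ^+ i * q2 ^+ j)%:E)); last first.
  by move=> i j _ _; rewrite lee_fin !mulr_ge0 ?exprn_ge0 ?expR_ge0.
transitivity (\esum_(i in [set: nat]) (q1 / (1 - q2) * q1 ^+ i)%:E)%E.
  apply: eq_esum => i _; rewrite -nneseries_esumT; last first.
    by move=> j; rewrite lee_fin !mulr_ge0 ?exprn_ge0 ?expR_ge0.
  by case/andP: q2B => ? ?; rewrite nneseries_geometric // mulrAC.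
case/andP: q1B => ? ?; case/andP: q2B => ? q2L.
rewrite -nneseries_esumT; last first.
  by move=> j; rewrite lee_fin !mulr_ge0 ?exprn_ge0 ?invr_ge0 ?subr_ge0 // ltW.
rewrite nneseries_geometric // /conegen -/q2 /q1 expRN; congr _%:E.
have : 1 < expR al by rewrite expR_gt1.
by move=> ?; field; rewrite ?gt_eqF //=; try (apply/andP; split); lra.
Qed.

End ConeGeneratingFunction.

(** * The weighted cones of a Hecke operator with nonnegative matrices *)

Section HeckeNonneg.
Context {R : realType}.

(** When [g] has a nonnegative representative, the absolute values of the entries of [repr g] are
    the entries of that representative, whichever sign [repr] chose. *)
Definition hsum (Q : nat -> nat -> nat -> nat -> R) (u : hecke_ring) : R :=
  hpair (fun g : pmx => Q (absz (repr g 0 0)) (absz (repr g 0 1))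
                          (absz (repr g 1 0)) (absz (repr g 1 1))) u.

Variables (n : nat) (Tn : hecke_ring).
Hypotheses (n0 : (0 < n)%N) (Tn_part : hecke_part n Tn)
  (Tn_periods : hecke_on_periods n Tn)
  (Tn_ge0 : forall g : pmx, g \in msupp Tn -> has_nonneg_repr g).

Lemma nonneg_repr_entries (g : pmx) : g \in msupp Tn ->
  exists a b c d : nat, [/\ (a * d = b * c + n)%N, g = pm (mx2 a b c d) &
    (repr g = mx2 a b c d \/ repr g = - mx2 a b c d)].
Proof.
move=> gT; have [m mg m0] := Tn_ge0 gT.
have := Tn_part gT; rewrite -mg pdetE {1}[m]mx2E det_mx2.
move: (m0 0 0) (m0 0 1) (m0 1 0) (m0 1 1).
have : repr (pm m) = mx2 (m 0 0) (m 0 1) (m 1 0) (m 1 1) \/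
    repr (pm m) = - mx2 (m 0 0) (m 0 1) (m 1 0) (m 1 1).
  by rewrite -mx2E; exact: repr_pm.
case: (m 0 0) (m 0 1) (m 1 0) (m 1 1) => // a [] // b [] // c [] // d.
move=> H _ _ _ _ det; exists a, b, c, d; split => //; first by lia.
rewrite -[pm m]reprK -/(pm (repr (pm m))); apply/eq_pm.
by case: H => ->; [left|right].
Qed.

Lemma eq_hsum (Q Q' : nat -> nat -> nat -> nat -> R) :
  (forall a b c d, (a * d = b * c + n)%N -> Q a b c d = Q' a b c d) ->
  hsum Q Tn = hsum Q' Tn.
Proof.
move=> QQ'; apply: eq_hpair => g /nonneg_repr_entries[a [b [c [d [det _ rE]]]]].
by apply: QQ'; case: rE => ->; rewrite ?oppmx2 !mxE /= ?abszN ?absz_nat.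
Qed.

Lemma hsumB (Q Q' : nat -> nat -> nat -> nat -> R) :
  hsum (fun a b c d => Q a b c d - Q' a b c d) Tn = hsum Q Tn - hsum Q' Tn.
Proof. by rewrite /hsum hpairB. Qed.

Lemma hsumZ k (Q : nat -> nat -> nat -> nat -> R) :
  hsum (fun a b c d => k * Q a b c d) Tn = k * hsum Q Tn.
Proof.
by rewrite /hsum !hpairE mulr_sumr; apply: eq_bigr => g _; rewrite mulrCA.
Qed.

Lemma hsumD (Q Q' : nat -> nat -> nat -> nat -> R) :
  hsum (fun a b c d => Q a b c d + Q' a b c d) Tn = hsum Q Tn + hsum Q' Tn.
Proof.
by rewrite /hsum !hpairE -big_split; apply: eq_bigr => g _; rewrite mulrDr.
Qed.

Lemma hsum_periods (P : int -> int -> int -> int -> R) :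
  (forall a b c d : int, P (- a) (- b) (- c) (- d) = P a b c d) ->
  (forall a b c d : int, P (a + c) (b + d) c d = P a b c d) ->
  hsum (fun a b c d => P a b c d - P (- c%:Z) (- d%:Z) a b) Tn =
  \sum_(d <- divisors n) \sum_(b < d)
    (P (n %/ d)%N%:Z (b : nat)%:Z 0 d%:Z -
     P (b : nat)%:Z (- (n %/ d)%N%:Z) d%:Z 0).
Proof.
move=> PN PT; rewrite -(hecke_on_periods_pairing Tn_periods PN PT).
apply: eq_hpair => g /nonneg_repr_entries[a [b [c [d [det _ rE]]]]].
case: rE => ->; rewrite ?oppmx2 !mxE /= ?abszN ?absz_nat //.
by rewrite !opprK -(PN a) -[P (- c%:Z) _ _ _]PN !opprK.
Qed.

Lemma hsum_in_cone u v :
  hsum (fun a b c d => (in_cone n u v a b c d)%:R) Tn =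
  \sum_(l <- divisors n) l%:R * (in_cone (l ^ 2) u v l 0 0 l)%:R.
Proof.
rewrite -sum_below_ray // -(@hsum_periods (fun a b c d => (below_ray n u v a b c d)%:R)).
- by apply: eq_hsum => a b c d det; rewrite below_rayB //; lia.
- by move=> *; rewrite below_rayN.
- by move=> *; rewrite below_rayT.
Qed.

(** Multiply [hsum_in_cone] by [e^(- t (u x + v))] and sum over all [(u, v)]. *)
Lemma hsum_conegen (x t : R) : 0 < x -> 0 < t ->
  hsum (fun a b c d =>
    conegen (t * (a%:R * x + b%:R)) (t * (c%:R * x + d%:R))) Tn =
  \sum_(l <- divisors n) l%:R * conegen (t * (l%:R * x)) (t * l%:R).
Proof.
move=> x0 t0; apply/eqP; rewrite -subr_eq0; apply/eqP.
pose W (p : nat * nat) := expR (- (t * (p.1%:R * x + p.2%:R))).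
pose e (g : pmx) : nat * nat * nat * nat :=
  (absz (repr g 0 0), absz (repr g 0 1), absz (repr g 1 0), absz (repr g 1 1)).
(* Matrices and divisors are put in one index set, so that the covering identity becomes a single
   vanishing combination, as [esum_lincomb] requires. *)
pose s : seq (pmx + nat)%type :=
  map inl (msupp Tn : seq pmx) ++ map inr (divisors n).
pose coef (i : (pmx + nat)%type) : R :=
  match i with inl g => ratr (mcoeff g Tn) | inr l => - l%:R end.
pose mem (i : (pmx + nat)%type) (p : nat * nat) : bool :=
  match i with
  | inl g => in_cone n p.1 p.2 (e g).1.1.1 (e g).1.1.2 (e g).1.2 (e g).2
  | inr l => in_cone (l ^ 2) p.1 p.2 l 0%N 0%N l end.
pose val (i : (pmx + nat)%type) : R :=
  match i with
  | inl g => conegen (t * ((e g).1.1.1%:R * x + (e g).1.1.2%:R))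
                     (t * ((e g).1.2%:R * x + (e g).2%:R))
  | inr l => conegen (t * (l%:R * x + 0%:R)) (t * (0%:R * x + l%:R)) end.
have := @esum_lincomb R (nat * nat)%type (pmx + nat)%type s coef
  (fun i p => (mem i p)%:R * W p) val.
rewrite big_cat !big_map /= => H; rewrite -[RHS]H.
- rewrite /hsum hpairE; congr (_ + _).
  rewrite -sumrN; apply: eq_bigr => l _.
  by rewrite mulNr addr0 mul0r add0r.
- by move=> i p; rewrite mulr_ge0 ?expR_ge0.
- move=> i; rewrite mem_cat => /orP[/mapP[g gT ->]|/mapP[l ln ->]] /=.
    have [a [b [c [d [det _ rE]]]]] := nonneg_repr_entries gT.
    rewrite -[absz (repr g 0 0)]/((e g).1.1.1) -[absz (repr g 0 1)]/((e g).1.1.2)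
      -[absz (repr g 1 0)]/((e g).1.2) -[absz (repr g 1 1)]/((e g).2).
    have -> : e g = (a, b, c, d).
      by rewrite /e; case: rE => ->; rewrite ?oppmx2 !mxE /= ?abszN ?absz_nat.
    exact: esum_cone.
  move: ln; rewrite -dvdn_divisors // => ln.
  have l0 := dvdn_gt0 n0 ln.
  by apply: esum_cone => //; rewrite ?expn_gt0 ?l0 // mul0n add0n mulnn.
- move=> p; rewrite big_cat !big_map /=.
  under [X in X + _]eq_bigr do rewrite mulrA.
  under [X in _ + X]eq_bigr do rewrite mulrA mulNr.
  rewrite -!mulr_suml -mulrDl sumrN -hsum_in_cone /hsum hpairE.
  by rewrite subrr mul0r.
Qed.

End HeckeNonneg.

(** * Differentiation rules in composable form *)

Section DerivativeRules.
Context {R : realType}.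
Implicit Types (f g : R -> R) (x df dg c : R).

Lemma der_val f x df dg : is_derive x 1 f df -> df = dg -> is_derive x 1 f dg.
Proof. by move=> + <-. Qed.

Lemma der_cst c x : is_derive x 1 (fun=> c) 0.
Proof. exact: is_derive_cst. Qed.

Lemma der_id x : is_derive x 1 (fun y : R => y) 1.
Proof. exact: is_derive_id. Qed.

Lemma der_add f g x df dg : is_derive x 1 f df -> is_derive x 1 g dg ->
  is_derive x 1 (fun y => f y + g y) (df + dg).
Proof. exact: is_deriveD. Qed.

Lemma der_opp f x df : is_derive x 1 f df ->
  is_derive x 1 (fun y => - f y) (- df).
Proof. exact: is_deriveN. Qed.

Lemma der_mul f g x df dg : is_derive x 1 f df -> is_derive x 1 g dg ->
  is_derive x 1 (fun y => f y * g y) (f x * dg + g x * df).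
Proof. exact: is_deriveM. Qed.

Lemma der_inv f x df : f x != 0 -> is_derive x 1 f df ->
  is_derive x 1 (fun y => (f y)^-1) (- (f x) ^- 2 * df).
Proof. exact: is_deriveV. Qed.

Lemma der_exp f x df : is_derive x 1 f df ->
  is_derive x 1 (fun y => expR (f y)) (expR (f x) * df).
Proof. by move=> fd; apply: is_derive1_comp. Qed.

Lemma der_ln f x df : 0 < f x -> is_derive x 1 f df ->
  is_derive x 1 (fun y => ln (f y)) ((f x)^-1 * df).
Proof.
by move=> f0 fd; apply: is_derive1_comp; exact: is_derive1_ln.
Qed.

Lemma der_eq_near f g x df : (\forall y \near x, f y = g y) ->
  is_derive x 1 f df -> is_derive x 1 g df.
Proof. by move=> fg fd; apply: near_eq_is_derive fd. Qed.

Lemma der_continuous f x df : is_derive x 1 f df -> {for x, continuous f}.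
Proof.
by move=> fd; apply/differentiable_continuous/derivable1_diffP; case: fd.
Qed.

Lemma derive1_val f x df : is_derive x 1 f df -> derive1 f x = df.
Proof. by move=> fd; rewrite derive1E; exact: derive_val. Qed.

Lemma near_gt0 x : 0 < x -> \forall y \near x, 0 < y.
Proof. exact: lt_nbhsr. Qed.

Lemma derive0_cst f : (forall x, 0 < x -> is_derive x 1 f 0) ->
  forall x, 0 < x -> f x = f 1.
Proof.
move=> fd.
have aux a b : 0 < a -> a < b -> f b = f a.
  move=> a0 ab; apply/eqP; rewrite -subr_eq0; apply/eqP.
  have [||c _ ->] := @MVT R f (fun=> 0) a b ab.
  - move=> c; rewrite in_itv /= => /andP[ac _].
    by apply: fd; exact: lt_trans ac.
  - apply: derivable_within_continuous => c; rewrite in_itv /= => /andP[ac _].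
    by case: (fd c (lt_le_trans a0 ac)).
  - by rewrite mul0r.
move=> x x0; case: (ltgtP x 1) => [x1|x1|-> //].
- by rewrite (aux _ _ x0 x1).
- by rewrite (aux _ _ ltr01 x1).
Qed.

End DerivativeRules.

(* Type class resolution would pick instances whose derivative has another *)
(* shape, so it is switched off. *)
Ltac der := repeat first
  [ notypeclasses refine (der_cst _ _)
  | notypeclasses refine (der_id _)
  | notypeclasses refine (der_add _ _)
  | notypeclasses refine (der_opp _)
  | notypeclasses refine (der_mul _ _)
  | notypeclasses refine (der_inv _ _)
  | notypeclasses refine (der_exp _)
  | notypeclasses refine (der_ln _ _) ].

Ltac derv := notypeclasses refine (der_val _ _); [der|cbn beta].

Local Notation mu := lebesgue_measure.

(** * Integration on the positive half-line *)

Section IntegralsOnHalfLine.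
Context {R : realType}.
Local Notation Ioo := (`](0 : R), +oo[%classic).
Implicit Types (f g F : R -> R) (t x : R).

Local Notation intble f := ((@mu R).-integrable Ioo (EFin \o f)).

Lemma IooE t : Ioo t = (0 < t) :> Prop.
Proof. by rewrite /= in_itv /= andbT. Qed.

Lemma measurable_Ioo_der f :
  (forall t, 0 < t -> exists d, is_derive t 1 f d) ->
  measurable_fun Ioo f.
Proof.
move=> fd; apply: open_continuous_measurable_fun => //.
move=> t; rewrite in_setE IooE => t0; have [d] := fd t t0.
exact: der_continuous.
Qed.

Lemma intble_le f g : measurable_fun Ioo f -> intble g ->
  (forall t, 0 < t -> `|f t| <= g t) -> intble f.
Proof.
move=> mf ig fg; apply: (le_integrable _ _ _ ig) => //.
  exact/measurable_EFinP.
move=> t; rewrite IooE => t0 /=; rewrite lee_fin.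
by rewrite (le_trans (fg t t0)) ?ler_norm.
Qed.

Lemma intble_measurable f : intble f -> measurable_fun Ioo f.
Proof. by case/integrableP => /measurable_EFinP. Qed.

Lemma eq_intble f g : (forall t, 0 < t -> f t = g t) -> intble f -> intble g.
Proof.
move=> fg; apply: eq_integrable => // t; rewrite in_setE IooE => t0 /=.
by rewrite fg.
Qed.

Lemma intbleD f g : intble f -> intble g -> intble (fun t => f t + g t).
Proof. exact: integrableD. Qed.

Lemma intbleZ k f : intble f -> intble (fun t => k * f t).
Proof. exact: integrableZl. Qed.

Lemma intbleN f : intble f -> intble (fun t => - f t).
Proof. by move=> /(intbleZ (-1)); apply: eq_intble => t _; rewrite mulN1r. Qed.

Lemma intbleB f g : intble f -> intble g -> intble (fun t => f t - g t).
Proof. by move=> fi gi; apply: intbleD => //; exact: intbleN. Qed.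

Lemma intble0 : intble (fun=> 0).
Proof. exact: integrable0. Qed.

Lemma intble_sum (I : eqType) (r : seq I) (c : I -> R) (f : I -> R -> R) :
  (forall i, i \in r -> intble (f i)) ->
  intble (fun t => \sum_(i <- r) c i * f i t).
Proof.
elim: r => [|i r IH] fi.
  by apply: eq_intble intble0 => t _; rewrite big_nil.
apply: (@eq_intble (fun t => c i * f i t + \sum_(j <- r) c j * f j t)).
  by move=> t _; rewrite big_cons.
apply: intbleD; first by apply/intbleZ/fi; rewrite mem_head.
by apply: IH => j jr; apply: fi; rewrite in_cons jr orbT.
Qed.

Lemma Rintegral_Ioo_eq f g : (forall t, 0 < t -> f t = g t) ->
  \int[mu]_(t in Ioo) f t = \int[mu]_(t in Ioo) g t.
Proof.
by move=> fg; apply: eq_Rintegral => t; rewrite in_setE IooE => t0; exact: fg.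
Qed.

Lemma Rintegral_Ioo_sum (I : eqType) (r : seq I) (c : I -> R) (f : I -> R -> R) :
  (forall i, i \in r -> intble (f i)) ->
  \int[mu]_(t in Ioo) (\sum_(i <- r) c i * f i t) =
  \sum_(i <- r) c i * \int[mu]_(t in Ioo) f i t.
Proof.
elim: r => [|i r IH] fi.
  rewrite big_nil (Rintegral_Ioo_eq (g := fun=> 0)).
    by rewrite Rintegral_cst // mul0r.
  by move=> t _; rewrite big_nil.
have fi0 : intble (f i) by apply: fi; rewrite mem_head.
have fir j : j \in r -> intble (f j).
  by move=> jr; apply: fi; rewrite in_cons jr orbT.
rewrite big_cons -IH // -RintegralZl // -RintegralD //.
- by apply: Rintegral_Ioo_eq => t _; rewrite big_cons.
- exact: intbleZ.
- exact: intble_sum.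
Qed.

Lemma Rintegral_dominated_cvg (f_ : nat -> R -> R) f g :
  (forall k, measurable_fun Ioo (f_ k)) ->
  (forall t, 0 < t -> f_ k t @[k --> \oo] --> f t) ->
  intble g -> (forall k t, 0 < t -> `|f_ k t| <= g t) ->
  \int[mu]_(t in Ioo) f_ k t @[k --> \oo] --> \int[mu]_(t in Ioo) f t.
Proof.
move=> mf ff ig fg; apply: fine_cvg => /=.
have mf' : measurable_fun Ioo f.
  by apply: (measurable_fun_cvg mf) => t; rewrite IooE => /ff.
have h1 k : measurable_fun Ioo (EFin \o f_ k) by exact/measurable_EFinP.
have h2 : measurable_fun Ioo (EFin \o f) by exact/measurable_EFinP.
have h3 t : Ioo t -> (EFin \o f_ k) t @[k --> \oo] --> (EFin \o f) t.
  by rewrite IooE => t0; apply: cvg_EFin; [exact: nearW | exact: ff].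
have h4 t k : Ioo t -> (`|(EFin \o f_ k) t| <= (EFin \o g) t)%E.
  by rewrite IooE => t0 /=; rewrite lee_fin fg.
have [fi _ H] := @dominated_convergence _ _ _ (@mu R) Ioo
  (measurable_itv _) _ _ _ h1 h2 (aeW (@mu R) h3) ig (aeW (@mu R) h4).
by rewrite fineK; [exact: H | exact: integrable_fin_num].
Qed.

(** Dominated convergence for the restrictions of [f] to the segments, with bound [|f|]. *)
Lemma cvg_Rintegral_Ioo f (u v : nat -> R) : intble f ->
  (forall k, 0 < u k) -> u k @[k --> \oo] --> 0 -> v k @[k --> \oo] --> +oo ->
  \int[mu]_(t in `[u k, v k]) f t @[k --> \oo] --> \int[mu]_(t in Ioo) f t.
Proof.
move=> fi u0 ucvg vcvg.
have E k : \int[mu]_(t in `[u k, v k]) f t =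
    \int[mu]_(t in Ioo) (f \_ `[u k, v k]) t.
  rewrite -Rintegral_mkcondr; congr Rintegral; apply/seteqP; split => t /=.
    rewrite !in_itv /= => /andP[ut tv]; rewrite ut tv andbT.
    by rewrite (lt_le_trans (u0 k) ut).
  by case.
under eq_fun do rewrite E.
apply: (@Rintegral_dominated_cvg _ _ (fun t => `|f t|)).
- move=> k; apply/measurable_restrict => //.
  by apply: measurable_funS (intble_measurable fi) => //; exact: subIsetl.
- move=> t t0; apply: cvg_near_cst; near=> k.
  rewrite patchE mem_set //= in_itv /=; apply/andP; split.
    by near: k; move/cvgr_le: ucvg; apply.
  by near: k; move/cvgry_ge : vcvg; apply.
- exact: integrable_norm.
- move=> k t t0; rewrite patchE; case: ifP => // _.
  by rewrite normr0.
Unshelve. all: by end_near. Qed.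

Lemma within_continuous_der f (a b : R) : 0 < a ->
  (forall t, 0 < t -> {for t, continuous f}) -> {within `[a, b], continuous f}.
Proof.
move=> a0 fc; apply: continuous_in_subspaceT => t.
rewrite in_setE /= in_itv /= => /andP[tab _].
by apply: fc; exact: lt_le_trans tab.
Qed.

Lemma Rintegral_segment_FTC F f (a b : R) : 0 < a -> a < b ->
  (forall t, 0 < t -> is_derive t 1 F (f t)) ->
  (forall t, 0 < t -> {for t, continuous f}) ->
  \int[mu]_(t in `[a, b]) f t = F b - F a.
Proof.
move=> a0 ab Fd fc; rewrite /Rintegral (@continuous_FTC2 _ f F a b) //.
- exact: within_continuous_der.
- have Fc t : 0 < t -> {for t, continuous F}.
    by move=> t0; exact: der_continuous (Fd t t0).
  split.
  + move=> t; rewrite in_itv /= => /andP[at_ _].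
    by case: (Fd t (lt_trans a0 at_)).
  + exact/cvg_at_right_filter/Fc.
  + exact/cvg_at_left_filter/Fc/(lt_trans a0).
- move=> t; rewrite in_itv /= => /andP[at_ _].
  exact: derive1_val (Fd t (lt_trans a0 at_)).
Qed.

Lemma cvg_harm0 : (k.+1%:R^-1 : R) @[k --> \oo] --> 0.
Proof. exact: cvg_harmonic. Qed.

Lemma cvg_natS_pinfty : (k.+2%:R : R) @[k --> \oo] --> +oo.
Proof.
apply/cvgryPge => A; near=> k.
apply: (@le_trans _ _ k%:R); last by rewrite ler_nat; lia.
by near: k; exact: nbhs_infty_ger.
Unshelve. all: by end_near. Qed.

Lemma cvg_natS_pinfty_comp (V : topologicalType) (F : R -> V) (l : V) :
  F t @[t --> +oo] --> l -> F k.+2%:R @[k --> \oo] --> l.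
Proof. by move=> Fl; apply: (cvg_comp _ _ cvg_natS_pinfty Fl). Qed.

Lemma cvg_harm_at_right F (l : R) :
  F t @[t --> 0^'+] --> l -> F (k.+1%:R^-1) @[k --> \oo] --> l.
Proof.
move=> /cvg_at_rightP; apply; split => [k|]; last exact: cvg_harm0.
by rewrite invr_gt0 ltr0n.
Qed.

Lemma Rintegral_Ioo_FTC F f (l0 l1 : R) :
  (forall t, 0 < t -> is_derive t 1 F (f t)) ->
  (forall t, 0 < t -> {for t, continuous f}) -> intble f ->
  F t @[t --> 0^'+] --> l0 -> F t @[t --> +oo] --> l1 ->
  \int[mu]_(t in Ioo) f t = l1 - l0.
Proof.
move=> Fd fc fi F0 F1.
(* The upper end [k.+2] keeps the segment nondegenerate at [k = 0]. *)
have H := @cvg_Rintegral_Ioo f (fun k => k.+1%:R^-1) (fun k => k.+2%:R) fi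
  (fun k => _) cvg_harm0 cvg_natS_pinfty.
have {}H := H (fun k => ltac:(by rewrite invr_gt0 ltr0n)).
apply/esym; apply: (cvg_unique _ _ H) => //.
have E k : \int[mu]_(t in `[k.+1%:R^-1, k.+2%:R]) f t =
    F k.+2%:R - F k.+1%:R^-1.
  apply: Rintegral_segment_FTC => //.
  apply: (@le_lt_trans _ _ 1); last by rewrite ltr1n.
  by rewrite invf_le1 ?ltr0n // ler1n.
rewrite /=; under eq_fun do rewrite E.
by apply: cvgB; [exact: cvg_natS_pinfty_comp | exact: cvg_harm_at_right].
Qed.

(** Monotone convergence: over the exhausting segments the integrals of the nonnegative [f] are
    differences of values of [F], with the finite limit [l1 - l0]. *)
Lemma intble_FTC F f (l0 l1 : R) :
  (forall t, 0 < t -> is_derive t 1 F (f t)) ->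
  (forall t, 0 < t -> {for t, continuous f}) ->
  (forall t, 0 < t -> 0 <= f t) ->
  F t @[t --> 0^'+] --> l0 -> F t @[t --> +oo] --> l1 -> intble f.
Proof.
move=> Fd fc f0 F0 F1.
have mf : measurable_fun Ioo f.
  apply: open_continuous_measurable_fun => //.
  by move=> t; rewrite in_setE IooE => /fc.
pose A k : set R := `[k.+1%:R^-1, k.+2%:R]%classic.
have UA : \bigcup_k A k = Ioo.
  apply/seteqP; split => t.
    move=> [k _]; rewrite /A IooE /= in_itv /= => /andP[kt _].
    by apply: lt_le_trans kt; rewrite invr_gt0 ltr0n.
  rewrite IooE => t0.
  have [k Hk] : exists k, k.+1%:R^-1 <= t /\ t <= k.+2%:R.
    near \oo => k; exists k; split; near: k.
      by have /cvgr_le := cvg_harm0; apply.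
    by have /cvgry_ge := cvg_natS_pinfty; apply.
  by exists k => //; rewrite /A /= in_itv /=; apply/andP.
have H : (\int[mu]_(t in A k) (f t)%:E)%E @[k --> \oo] -->
    (\int[mu]_(t in Ioo) (f t)%:E)%E.
  rewrite -UA; apply: ge0_nondecreasing_set_cvg_integral.
  - move=> k m km; apply/subsetPset => t; rewrite /A /= !in_itv /=.
    move=> /andP[h1 h2]; apply/andP; split.
      apply: le_trans h1; rewrite lef_pV2 ?posrE ?ltr0n // ler_nat; lia.
    by apply: le_trans h2 _; rewrite ler_nat; lia.
  - by move=> k; exact: measurable_itv.
  - move=> k; apply/measurable_EFinP; apply: measurable_funS mf => //.
    by rewrite -UA => t Akt; exists k.
  - move=> k t Akt; rewrite lee_fin; apply: f0; rewrite -IooE -UA.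
    by exists k.
have E k : (\int[mu]_(t in A k) (f t)%:E)%E = (F k.+2%:R - F k.+1%:R^-1)%:E.
  have k0 : 0 < k.+1%:R^-1 :> R by rewrite invr_gt0 ltr0n.
  have kk : k.+1%:R^-1 < k.+2%:R :> R.
    apply: (@le_lt_trans _ _ 1); last by rewrite ltr1n.
    by rewrite invf_le1 ?ltr0n // ler1n.
  rewrite -(Rintegral_segment_FTC k0 kk Fd fc) /Rintegral fineK //.
  apply: integrable_fin_num => //; apply: continuous_compact_integrable.
    exact: segment_compact.
  exact: within_continuous_der.
have H' : (\int[mu]_(t in A k) (f t)%:E)%E @[k --> \oo] --> (l1 - l0)%:E.
  under eq_fun do rewrite E.
  apply: cvg_EFin; first exact: nearW.
  by apply: cvgB; [exact: cvg_natS_pinfty_comp | exact: cvg_harm_at_right].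
apply/integrableP; split; first exact/measurable_EFinP.
rewrite (_ : integral _ _ _ = (\int[mu]_(t in Ioo) (f t)%:E)%E); last first.
  by apply: eq_integral => t; rewrite in_setE IooE => t0 /=; rewrite ger0_norm ?f0.
by rewrite (cvg_unique _ H H') ?ltry //.
Unshelve. all: by end_near. Qed.

(** Substitution on compact segments, followed by the limit on both sides. *)
Lemma Rintegral_Ioo_scale f (c : R) : 0 < c ->
  (forall t, 0 < t -> {for t, continuous f}) ->
  intble f -> intble (fun t => f (c * t)) ->
  c * \int[mu]_(t in Ioo) f (c * t) = \int[mu]_(t in Ioo) f t.
Proof.
move=> c0 fc fi fci.
pose u k : R := k.+1%:R^-1; pose v k : R := k.+2%:R.
have u0 k : 0 < u k by rewrite invr_gt0 ltr0n.
have uv k : u k < v k.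
  apply: (@le_lt_trans _ _ 1); last by rewrite ltr1n.
  by rewrite invf_le1 ?ltr0n // ler1n.
rewrite -RintegralZl //.
have H1 := @cvg_Rintegral_Ioo _ u v (intbleZ c fci) u0 cvg_harm0 cvg_natS_pinfty.
have H2 := @cvg_Rintegral_Ioo f (fun k => c * u k) (fun k => c * v k) fi.
apply: (cvg_unique _ H1) => //.
have E k : \int[mu]_(t in `[u k, v k]) (c * f (c * t)) =
   \int[mu]_(t in `[c * u k, c * v k]) f t.
  have dc (t : R) : is_derive t 1 (fun y => c * y) c.
    by derv; rewrite mulr1 mulr0 addr0.
  have dc1 : derive1 (fun y : R => c * y) = cst c.
    by apply/funext => t; exact: derive1_val (dc t).
  rewrite /Rintegral; congr fine; apply/esym.
  rewrite (@integration_by_substitution_increasing R (fun y => c * y)) //.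
  - by rewrite dc1; apply: eq_integral => t _ /=; rewrite /= mulrC.
  - exact/ltW.
  - by move=> x y _ _ xy; rewrite ltr_pM2l.
  - by rewrite dc1 => t _; exact: cvg_cst.
  - by rewrite dc1; exact: is_cvg_cst.
  - by rewrite dc1; exact: is_cvg_cst.
  - split.
    + by move=> t _; case: (dc t).
    + exact/cvg_at_right_filter/(der_continuous (dc _)).
    + exact/cvg_at_left_filter/(der_continuous (dc _)).
  - by apply: within_continuous_der => //; exact: mulr_gt0.
rewrite /=; under eq_fun do rewrite E.
apply: H2.
- by move=> k; exact: mulr_gt0.
- by rewrite -[X in _ --> X](mulr0 c); apply: cvgMr; exact: cvg_harm0.
- apply/cvgryPge => A; near=> k; rewrite mulrC -ler_pdivrMr //.
  by near: k; move/cvgryPge : cvg_natS_pinfty; apply.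
Unshelve. all: by end_near. Qed.

Lemma is_derive_Rintegral (f df : R -> R -> R) (x u v : R) g :
  u < x < v ->
  (forall y, u < y < v -> intble (f y)) ->
  (forall y t, u < y < v -> 0 < t -> is_derive y 1 (f^~ t) (df y t)) ->
  intble g ->
  (forall y t, u < y < v -> 0 < t -> `|df y t| <= g t) ->
  is_derive x 1 (fun y => \int[mu]_(t in Ioo) f y t)
    (\int[mu]_(t in Ioo) df x t).
Proof.
move=> xuv fi fd gi fg.
have I y : `]u, v[%classic y = (u < y < v) :> Prop by rewrite /= in_itv.
have d1E y t : u < y < v -> 0 < t -> partial1of2 f y t = df y t.
  by move=> yuv t0; exact: derive1_val (fd y t yuv t0).
have H1 : forall y, `]u, v[%classic y -> intble (f y).
  by move=> y; rewrite I => /fi.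
have H2 : forall y t, `]u, v[%classic y -> Ioo t -> derivable (f^~ t) y 1.
  by move=> y t; rewrite I IooE => yuv t0; case: (fd y t yuv t0).
have H3 : forall y t, `]u, v[%classic y -> Ioo t -> `|partial1of2 f y t| <= `|g t|.
  move=> y t; rewrite I IooE => yuv t0; rewrite d1E //.
  by rewrite (le_trans (fg y t yuv t0)) ?ler_norm.
have xI : `]u, v[%classic x by rewrite I.
have gi' := integrable_norm gi.
have D := @derivable_under_integral R _ _ (@mu R) f Ioo (measurable_itv _) x u v xI
  H1 H2 (fun t => `|g t|) (fun t => normr_ge0 _) gi' H3.
have V := @differentiation_under_integral R _ _ (@mu R) f Ioo (measurable_itv _)
  x u v xI H1 H2 (fun t => `|g t|) (fun t => normr_ge0 _) gi' H3.
apply: DeriveDef => //; rewrite -derive1E V.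
by apply: Rintegral_Ioo_eq => t t0; rewrite d1E.
Qed.

End IntegralsOnHalfLine.

(** * The Gamma function and elementary bounds for [digamma] *)

Section GammaFunction.
Context {R : realType}.
Local Notation Ioo := (`](0 : R), +oo[%classic).
Local Notation intble f := ((@mu R).-integrable Ioo (EFin \o f)).
Implicit Types (x t s a : R).

Lemma powR_gt0E t p : 0 < t -> t `^ p = expR (p * ln t).
Proof. by move=> t0; rewrite /powR gt_eqF. Qed.

Lemma ln_le_subr1 t : 0 < t -> ln t <= t - 1.
Proof.
move=> t0; rewrite -[t in leLHS](subrK 1) [_ + 1]addrC.
by apply: le_ln1Dx; rewrite ltrBrDr addNr.
Qed.

Lemma cvg_pinfty_inv (F : R -> R) (l C : R) :
  (forall t, 0 < t -> `|F t - l| <= C / t) -> F t @[t --> +oo] --> l.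
Proof.
move=> H; apply/cvgrPdist_le => e e0; near=> t.
have t0 : 0 < t by near: t; exact: nbhs_pinfty_gt.
rewrite distrC (le_trans (H t t0)) // ler_pdivrMr // mulrC -ler_pdivrMr //.
Unshelve. all: by end_near. Qed.

Lemma cvg_at_right0_powR (F : R -> R) (l C p : R) : 0 < p ->
  (forall t, 0 < t -> `|F t - l| <= C * t `^ p) -> F t @[t --> 0^'+] --> l.
Proof.
move=> p0 H.
have Cp : C * t `^ p @[t --> 0^'+] --> 0.
  by rewrite -[X in _ --> X](mulr0 C); apply: cvgMr; exact: powR_cvg0.
apply/cvgrPdist_le => e e0; near=> t.
have t0 : 0 < t by near: t; exact: nbhs_right_gt.
rewrite distrC (le_trans (H t t0)) //.
have -> : C * t `^ p = C * t `^ p - 0 by rewrite subr0.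
rewrite (le_trans (ler_norm _)) // distrC.
by near: t; move/cvgrPdist_le : Cp; apply.
Unshelve. all: by end_near. Qed.

(** This is [ln y <= y] at [y = a t / p], multiplied by [p]; it bounds powers by exponentials. *)
Lemma lnM_le p a t : 0 < p -> 0 < a -> 0 < t ->
  p * ln t <= p * ln (p / a) + a * t.
Proof.
move=> p0 a0 t0.
have pa : 0 < p / a by rewrite divr_gt0.
have y0 : 0 < t / (p / a) by rewrite divr_gt0.
have -> : t = (p / a) * (t / (p / a)) by rewrite mulrC divfK // gt_eqF.
rewrite lnM ?posrE // mulrDr lerD2l.
have -> : a * (p / a * (t / (p / a))) = p * (t / (p / a)).
  by field; rewrite !gt_eqF.
by rewrite ler_pM2l // ltW // ln_sublinear.
Qed.

(** Comparison with the derivative [f] of [G = (t / (1 + t))^s], which increases from [0] to [1];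
    here [f = s t^(s - 1) / (1 + t)^(s + 1)]. *)
Lemma intble_powR_exp s a : 0 < s -> 0 < a ->
  intble (fun t => t `^ (s - 1) * expR (- (a * t))).
Proof.
move=> s0 a0.
pose G t := expR (s * (ln t - ln (1 + t))).
pose f t := G t * (s / (t * (1 + t))).
have t1 t : 0 < t -> 0 < 1 + t by move=> t0; rewrite addr_gt0.
have Gd t : 0 < t -> is_derive t 1 G (f t).
  move=> t0; have ? := t1 _ t0; derv => //.
  rewrite /f /G; field.
  by rewrite !gt_eqF.
have fc t : 0 < t -> {for t, continuous f}.
  move=> t0; have ? := t1 _ t0.
  rewrite /f /G; eapply der_continuous; der => //.
  by rewrite gt_eqF // mulr_gt0.
have f0 t : 0 < t -> 0 <= f t.
  move=> t0; have ? := t1 _ t0.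
  by rewrite /f mulr_ge0 ?expR_ge0 // divr_ge0 ?mulr_ge0 // ltW.
have fi : intble f.
  apply: (intble_FTC (F := G) (l0 := 0) (l1 := 1)) => //.
    apply: (@cvg_at_right0_powR _ _ 1 s) => // t t0.
    rewrite subr0 mul1r ger0_norm ?expR_ge0 // powR_gt0E // ler_expR.
    by rewrite ler_pM2l // lerBlDr lerDl ln_ge0 // lerDl ltW.
  apply: (@cvg_pinfty_inv _ _ s) => t t0; have ? := t1 _ t0.
  have y0 : 0 <= ln (1 + t) - ln t.
    by rewrite subr_ge0 ler_ln ?posrE // lerDr.
  have y1 : ln (1 + t) - ln t <= t^-1.
    rewrite -ln_div ?posrE // mulrDl mul1r divff ?gt_eqF // addrC.
    by apply: le_ln1Dx; apply: lt_trans (ltrN10 _) _; rewrite invr_gt0.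
  have -> : G t = expR (- (s * (ln (1 + t) - ln t))).
    by rewrite /G; congr expR; ring.
  rewrite ler0_norm; last first.
    by rewrite subr_le0 expR_le1 oppr_le0 mulr_ge0 // ltW.
  rewrite opprB; have := expR_ge1Dx (- (s * (ln (1 + t) - ln t))).
  have : s * (ln (1 + t) - ln t) <= s / t by rewrite ler_pM2l.
  by move=> h1 h2; lra.
have E3 (X Y Z : R) : expR (X + Y - Z) = expR X * expR Y / expR Z.
  by rewrite expRB expRD.
pose p := s + 1.
(* By [lnM_le] at [1 + t], the numerator bounds [(1 + t)^p e^(- a t)]; dividing by [s] cancels the
   factor [s] of [f]. *)
pose C := expR (p * ln (p / a) + a) / s.
apply: intble_le (intbleZ C fi) _.
  apply: (measurable_Ioo_der (f := fun t => t `^ (s - 1) * expR (- (a * t)))) => t t0.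
  eexists; apply: (@der_eq_near _ (fun t => expR ((s - 1) * ln t) * expR (- (a * t)))).
    near=> y; rewrite powR_gt0E //; near: y; exact: near_gt0.
  by der.
move=> t t0; have ? := t1 _ t0.
rewrite ger0_norm ?mulr_ge0 ?powR_ge0 ?expR_ge0 // powR_gt0E //.
have -> : C * f t =
    expR ((s - 1) * ln t) * expR (p * ln (p / a) + a - p * ln (1 + t)).
  rewrite /C /f /G /p.
  have -> : (t * (1 + t)) = expR (ln t + ln (1 + t)).
    by rewrite expRD !lnK ?posrE.
  rewrite -expRD [_ + _ in RHS](_ : _ = ((s + 1) * ln ((s + 1) / a) + a) +
    s * (ln t - ln (1 + t)) - (ln t + ln (1 + t))); last by ring.
  rewrite E3; field.
  by rewrite !gt_eqF ?expR_gt0.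
rewrite ler_pM2l ?expR_gt0 // ler_expR.
have p0 : 0 < p by rewrite addr_gt0.
have := lnM_le p0 a0 (t1 _ t0).
by rewrite mulrDr mulr1 => ?; lra.
Unshelve. all: by end_near. Qed.

Definition gamma_integrand x t : R := expR ((x - 1) * ln t - t).

Lemma gamma_integrandE x t : 0 < t ->
  t `^ (x - 1) * expR (- t) = gamma_integrand x t.
Proof. by move=> t0; rewrite /gamma_integrand powR_gt0E // -expRD. Qed.

Lemma intble_gamma x : 0 < x -> intble (gamma_integrand x).
Proof.
move=> x0; apply: eq_intble (intble_powR_exp x0 ltr01) => t t0.
by rewrite mul1r gamma_integrandE.
Qed.

Lemma GammaE x : Gamma x = \int[mu]_(t in Ioo) gamma_integrand x t.
Proof. by apply: Rintegral_Ioo_eq => t t0; rewrite gamma_integrandE. Qed.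

(** From [z <= e^(e z) / e] at [z = |ln t|]: the logarithm costs a factor [t^e] or [t^(- e)], and
    moving from [y] to [x] at most another. The bound is uniform in [y], as differentiation under
    the integral requires. *)
Lemma ln_gamma_le (x y e t : R) : 0 < e -> `|y - x| <= e -> 0 < t ->
  `|ln t * gamma_integrand y t| <=
  e^-1 * (gamma_integrand (x + 2 * e) t + gamma_integrand (x - 2 * e) t).
Proof.
move=> e0; rewrite ler_norml => /andP[yx1 yx2] t0.
rewrite normrM (ger0_norm (expR_ge0 _)).
have key (z : R) : 0 <= z -> z <= e^-1 * expR (e * z).
  move=> z0; rewrite mulrC ler_pdivlMr // mulrC.
  by have := expR_ge1Dx (e * z); lra.
have [l0|l0] := leP 0 (ln t).
  rewrite ger0_norm //; apply: (@le_trans _ _ (e^-1 * gamma_integrand (x + 2 * e) t)).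
    rewrite (le_trans (ler_wpM2r (expR_ge0 _) (key _ l0))) //.
    rewrite -mulrA ler_pM2l ?invr_gt0 // -expRD ler_expR.
    by nra.
  by rewrite ler_pM2l ?invr_gt0 // lerDl expR_ge0.
rewrite ltr0_norm //; apply: (@le_trans _ _ (e^-1 * gamma_integrand (x - 2 * e) t)).
  have l0' : 0 <= - ln t by rewrite oppr_ge0 ltW.
  rewrite (le_trans (ler_wpM2r (expR_ge0 _) (key _ l0'))) //.
  rewrite -mulrA ler_pM2l ?invr_gt0 // -expRD ler_expR.
  by nra.
by rewrite ler_pM2l ?invr_gt0 // lerDr expR_ge0.
Qed.

Lemma measurable_ln_gamma x :
  measurable_fun Ioo (fun t => ln t * gamma_integrand x t).
Proof.
apply: measurable_Ioo_der => t t0; eexists; rewrite /gamma_integrand; der => //.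
Qed.

Lemma intble_ln_gamma x : 0 < x -> intble (fun t => ln t * gamma_integrand x t).
Proof.
move=> x0; pose e := x / 4.
have e0 : 0 < e by rewrite /e divr_gt0.
apply: (intble_le (g := fun t => e^-1 *
    (gamma_integrand (x + 2 * e) t + gamma_integrand (x - 2 * e) t))).
- exact: measurable_ln_gamma.
- by apply: intbleZ; apply: intbleD; apply: intble_gamma; rewrite /e; lra.
- by move=> t t0; apply: ln_gamma_le => //; rewrite subrr normr0 ltW.
Qed.

Lemma is_derive_Gamma x : 0 < x ->
  is_derive x 1 Gamma (\int[mu]_(t in Ioo) (ln t * gamma_integrand x t)).
Proof.
move=> x0; rewrite (_ : Gamma = fun y => \int[mu]_(t in Ioo) gamma_integrand y t);
  last by apply/funext => y; exact: GammaE.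
(* With this choice [x - 2 * e] stays positive, so the dominating function is integrable. *)
pose e := x / 4.
have e0 : 0 < e by rewrite /e divr_gt0.
apply: (@is_derive_Rintegral _ _ (fun y t => ln t * gamma_integrand y t)
  x (x - e) (x + e) (fun t => e^-1 *
    (gamma_integrand (x + 2 * e) t + gamma_integrand (x - 2 * e) t))).
- by apply/andP; split; lra.
- by move=> y /andP[y1 y2]; apply: intble_gamma; rewrite /e in y1; lra.
- move=> y t _ t0; rewrite /gamma_integrand; derv; ring.
- by apply: intbleZ; apply: intbleD; apply: intble_gamma; rewrite /e; lra.
- move=> y t /andP[y1 y2] t0; apply: ln_gamma_le => //.
  by rewrite ler_norml; apply/andP; split; lra.
Qed.

(** On [[1, 2]] one has [0 <= ln t <= 1] and [t <= 2], so the integrand is at least the constant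
    [c]. *)
Lemma Gamma_gt0 x : 0 < x -> 0 < Gamma x.
Proof.
move=> x0; rewrite GammaE.
pose c := expR (- `|x - 1| - 2); pose A : set R := `[1, 2]%classic.
have cA : \int[mu]_(t in Ioo) ((cst c) \_ A) t = c.
  rewrite -Rintegral_mkcondr (_ : _ `&` A = A); last first.
    apply/seteqP; split => t [] //; rewrite /A /= !in_itv /= => /andP[t1 t2].
    by split; [rewrite andbT; exact: lt_le_trans t1 | apply/andP].
  rewrite Rintegral_cst; last exact: measurable_itv.
  have muA : fine (mu A) = 1.
    have := @lebesgue_measure_itv R `[1, 2]%R; rewrite /= lte_fin ltr1n /= => ->.
    by rewrite -EFinB /=; lra.
  by rewrite -[RHS]mulr1; congr (_ * _); exact: muA.
apply: (@lt_le_trans _ _ c); first exact: expR_gt0.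
rewrite -cA; apply: le_Rintegral => //.
- apply: (intble_le (g := fun t => c * expR 2 * expR (- (1 * t)))).
  + by apply/measurable_restrict => //; exact: measurable_itv.
  + apply: intbleZ; apply: eq_intble (intble_powR_exp ltr01 ltr01) => t t0.
    by rewrite subrr powRr0 mul1r.
  + move=> t t0; rewrite patchE; case: ifPn => [|_]; last first.
      by rewrite normr0 !mulr_ge0 ?expR_ge0.
    rewrite in_setE /A /= in_itv /= => /andP[t1 t2].
    rewrite ger0_norm ?expR_ge0 // -mulrA -expRD ler_peMr ?expR_ge0 //.
    by rewrite -[leLHS]expR0 ler_expR; lra.
- exact: intble_gamma.
move=> t; rewrite IooE => t0; rewrite patchE; case: ifPn => [|_]; last exact: expR_ge0.
rewrite in_setE /A /= in_itv /= => /andP[t1 t2].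
rewrite /c /gamma_integrand ler_expR.
have l0 : 0 <= ln t by rewrite ln_ge0.
have l1 : ln t <= 1.
  by have := ln_le_subr1 t0; lra.
have := ler_norm (- (x - 1)); rewrite normrN => H.
have : - `|x - 1| <= (x - 1) * ln t.
  have h0 := normr_ge0 (x - 1).
  by nra.
by lra.
Qed.

(** Integration by parts: the difference of the integrands is the derivative of [t^x e^(- t)], which
    vanishes at both ends. *)
Lemma Gamma_rec x : 0 < x -> Gamma (x + 1) = x * Gamma x.
Proof.
move=> x0; have x1 : 0 < x + 1 by rewrite addr_gt0.
apply/eqP; rewrite eq_sym -subr_eq0 !GammaE -RintegralZl //; last exact: intble_gamma.
rewrite -RintegralB //; [|exact/intbleZ/intble_gamma|exact: intble_gamma].
pose F t := expR (x * ln t - t).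
apply/eqP; rewrite -[RHS](subrr 0).
apply: (@Rintegral_Ioo_FTC _ F _ 0 0).
- move=> t t0; rewrite /F /gamma_integrand; derv => //.
  rewrite addrK (_ : (x - 1) * ln t - t = (x * ln t - t) - ln t); last by ring.
  set y := x * ln t - t; rewrite (expRB y) lnK ?posrE //.
  by field; rewrite gt_eqF.
- move=> t t0; rewrite /gamma_integrand; eapply der_continuous; der => //.
- by apply: intbleB; [exact/intbleZ/intble_gamma|exact: intble_gamma].
- apply: (@cvg_at_right0_powR _ _ 1 x) => // t t0.
  rewrite subr0 ger0_norm ?expR_ge0 // mul1r powR_gt0E // ler_expR.
  by rewrite gerBl ltW.
- apply: (@cvg_pinfty_inv _ _ (expR ((x + 1) * ln ((x + 1) / 1)))) => t t0.
  rewrite subr0 ger0_norm ?expR_ge0 // -{2}[t]lnK ?posrE // -expRB ler_expR.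
  by have := lnM_le x1 ltr01 t0; lra.
Qed.

(** The tangent bound [ln t <= ln x + t / x - 1], integrated against [t^(x - 1) e^(- t)]; the last
    two terms cancel by [Gamma_rec]. *)
Lemma digamma_le_ln x : 0 < x -> digamma x <= ln x.
Proof.
move=> x0; rewrite /digamma (derive1_val (is_derive_Gamma x0)).
rewrite ler_pdivrMr ?Gamma_gt0 //.
have -> : ln x * Gamma x =
    ln x * Gamma x + x^-1 * Gamma (x + 1) - Gamma x.
  by rewrite Gamma_rec // mulrA mulVf ?gt_eqF // mul1r addrK.
rewrite !GammaE -!RintegralZl //; try (apply: intble_gamma; lra).
rewrite -RintegralD //; try (apply: intbleZ; apply: intble_gamma; lra).
rewrite -RintegralB //; last 2 first.
- by apply: intbleD; apply: intbleZ; apply: intble_gamma; lra.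
- exact: intble_gamma.
apply: le_Rintegral => //.
- exact: intble_ln_gamma.
- by apply: intbleB; [apply: intbleD; apply: intbleZ|]; apply: intble_gamma; lra.
move=> t; rewrite IooE => t0.
have -> : gamma_integrand (x + 1) t = t * gamma_integrand x t.
  rewrite /gamma_integrand -{3}[t]lnK ?posrE // -expRD; congr expR; ring.
rewrite (_ : _ - _ = (ln x + x^-1 * t - 1) * gamma_integrand x t); last by ring.
rewrite ler_pM2r ?expR_gt0 //.
have h : 0 < t / x by rewrite divr_gt0.
have := ln_le_subr1 h; rewrite ln_div ?posrE //.
by rewrite mulrC; lra.
Qed.

(** Logarithmic differentiation of [Gamma_rec]: [d1] is computed by the chain rule and by the
    product rule. *)
Lemma digamma_rec x : 0 < x -> digamma (x + 1) = digamma x + x^-1.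
Proof.
move=> x0; have x1 : 0 < x + 1 by rewrite addr_gt0.
have G0 := Gamma_gt0 x0.
have D := is_derive_Gamma x0; have D1 := is_derive_Gamma x1.
set d := \int[mu]_(t in Ioo) _ in D; set d1 := \int[mu]_(t in Ioo) _ in D1.
have E : d1 = Gamma x + x * d.
  have H1 : is_derive x 1 (fun y => Gamma (y + 1)) d1.
    have H : is_derive x 1 (fun y : R => y + 1) 1.
      by derv; rewrite addr0.
    by have := @is_derive1_comp R Gamma (fun y => y + 1) x d1 1 D1 H; rewrite mulr1.
  have H2 : is_derive x 1 (fun y => Gamma (y + 1)) (x * d + Gamma x * 1).
    apply: (@der_eq_near _ (fun y => y * Gamma y)).
      by near=> y; rewrite Gamma_rec //; near: y; exact: near_gt0.
  by rewrite -(derive1_val H1) (derive1_val H2) mulr1 addrC.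
rewrite /digamma (derive1_val D) (derive1_val D1) E Gamma_rec //.
by field; rewrite !gt_eqF.
Unshelve. all: by end_near. Qed.

(** Here [ln t >= ln x + 1 - x / t] is integrated against [t^x e^(- t)]. *)
Lemma ln_le_digamma x : 0 < x -> ln x <= digamma (x + 1).
Proof.
move=> x0; have x1 : 0 < x + 1 by rewrite addr_gt0.
rewrite /digamma (derive1_val (is_derive_Gamma x1)).
rewrite ler_pdivlMr ?Gamma_gt0 //.
have -> : ln x * Gamma (x + 1) =
    ln x * Gamma (x + 1) + Gamma (x + 1) - x * Gamma x.
  by rewrite Gamma_rec // addrK.
rewrite !GammaE -!RintegralZl //; try (apply: intble_gamma; lra).
rewrite -RintegralD //; try (apply: intbleZ); try (apply: intble_gamma; lra).
rewrite -RintegralB //; last 2 first.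
- by apply: intbleD; first apply: intbleZ; apply: intble_gamma; lra.
- by apply: intbleZ; exact: intble_gamma.
apply: le_Rintegral => //.
- by apply: intbleB; [apply: intbleD; first apply: intbleZ|apply: intbleZ];
     apply: intble_gamma; lra.
- exact: intble_ln_gamma.
move=> t; rewrite IooE => t0.
have -> : gamma_integrand (x + 1) t = t * gamma_integrand x t.
  rewrite /gamma_integrand -{3}[t]lnK ?posrE // -expRD; congr expR; ring.
rewrite (_ : _ - _ = (ln x + 1 - x / t) * (t * gamma_integrand x t)); last first.
  by field; rewrite gt_eqF.
rewrite ler_pM2r ?mulr_gt0 ?expR_gt0 //.
have h : 0 < x / t by rewrite divr_gt0.
have := ln_le_subr1 h; rewrite ln_div ?posrE //.
by lra.
Qed.

Lemma digamma_sub_ln_bound x : 0 < x -> - x^-1 <= digamma x - ln x <= 0.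
Proof.
move=> x0; apply/andP; split; last by rewrite subr_le0 digamma_le_ln.
by have := ln_le_digamma x0; rewrite digamma_rec //; lra.
Qed.

End GammaFunction.

(** * The logarithmic series and its remainder *)

Section LogarithmicSeries.
Context {R : realType}.

Lemma der_pow (f : R -> R) (x df : R) n : is_derive x 1 f df ->
  is_derive x 1 (fun y => f y ^+ n) (n%:R * f x ^+ n.-1 * df).
Proof.
move=> fd; elim: n => [|n IH].
  by apply: der_val (der_cst _ _) _; rewrite !mul0r.
apply: (@der_val _ _ _ (f x * (n%:R * f x ^+ n.-1 * df) + f x ^+ n * df)).
  under eq_fun do rewrite exprS.
  exact: (der_mul fd IH).
case: n {IH} => [|n] /=; first by ring.
by rewrite exprS -[in RHS]natr1; ring.
Qed.

Lemma der_sum (I : eqType) (r : seq I) (f : I -> R -> R) (df : I -> R) (x : R) :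
  (forall i, i \in r -> is_derive x 1 (f i) (df i)) ->
  is_derive x 1 (fun y => \sum_(i <- r) f i y) (\sum_(i <- r) df i).
Proof.
elim: r => [|i r IH] fd.
  rewrite big_nil; under eq_fun do rewrite big_nil.
  exact: der_cst.
rewrite big_cons; under eq_fun do rewrite big_cons.
apply: der_add; first by apply: fd; rewrite mem_head.
by apply: IH => j jr; apply: fd; rewrite in_cons jr orbT.
Qed.

(** By the geometric sum the remainder has derivative [x^N / (1 - x)], which is nonnegative and
    increasing; the mean value theorem on [[0, q]] concludes. *)
Lemma ln_series_remainder (q : R) N : 0 <= q < 1 ->
  0 <= - ln (1 - q) - \sum_(0 <= k < N) q ^+ k.+1 / k.+1%:R
    <= q ^+ N / (1 - q).
Proof.
move=> /andP[q0 q1].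
pose f (x : R) := - ln (1 - x) - \sum_(0 <= k < N) x ^+ k.+1 / k.+1%:R.
have fd (x : R) : x < 1 -> is_derive x 1 f (x ^+ N / (1 - x)).
  move=> x1; have x1' : 0 < 1 - x by rewrite subr_gt0.
  apply: (@der_val _ _ _ (- ((1 - x)^-1 * (0 - 1)) -
      \sum_(0 <= k < N) x ^+ k)).
    apply: der_add; first by der.
    apply: der_opp; apply: der_sum => k _.
    have H : is_derive x 1 (fun y : R => y ^+ k.+1) (k.+1%:R * x ^+ k * 1).
      exact: (der_pow _ (der_id x)).
    apply: (der_val (der_mul H (der_cst _ _))).
    by rewrite mulr0 add0r mulr1 mulrA mulVf ?mul1r // pnatr_eq0.
  have := subrX1 x N; rewrite big_mkord => H.
  apply: (@mulIf _ (1 - x)); first by rewrite gt_eqF.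
  rewrite divfK ?gt_eqF // mulrBl sub0r mulrN1 opprK mulVf ?gt_eqF //.
  have -> : (\sum_(i < N) x ^+ i) * (1 - x) = - (x ^+ N - 1).
    by rewrite H; ring.
  ring.
have [||c] := @MVT_segment R f (fun x => x ^+ N / (1 - x)) 0 q q0.
  by move=> x; rewrite in_itv /= => /andP[_ xq]; apply: fd; exact: lt_trans xq q1.
  apply: derivable_within_continuous => x; rewrite in_itv /= => /andP[_ xq].
  by case: (fd x (le_lt_trans xq q1)).
rewrite in_itv /= => /andP[c0 cq].
have -> : f 0 = 0.
  rewrite /f subr0 ln1 oppr0 sub0r big1 ?oppr0 // => k _.
  by rewrite expr0n mul0r.
rewrite !subr0 /f => ->.
have c1 : c < 1 by exact: le_lt_trans cq q1.
have c1' : 0 < 1 - c by rewrite subr_gt0.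
have q1' : 0 < 1 - q by rewrite subr_gt0.
have h0 : 0 <= c ^+ N / (1 - c) by rewrite divr_ge0 ?exprn_ge0 // ltW.
rewrite mulr_ge0 //=.
apply: (@le_trans _ _ (c ^+ N / (1 - c))).
  by rewrite ler_piMr // ltW.
apply: ler_pM.
- exact: exprn_ge0.
- by rewrite invr_ge0 ltW.
- by rewrite lerXn2r ?nnegrE.
- by rewrite lef_pV2 ?posrE //; lra.
Qed.

Lemma cvg_ln_series (q : R) : 0 <= q < 1 ->
  series (fun k => q ^+ k.+1 / k.+1%:R) k @[k --> \oo] --> - ln (1 - q).
Proof.
move=> q01; have /andP[q0 q1] := q01.
have H : q ^+ N / (1 - q) @[N --> \oo] --> 0.
  rewrite -[X in _ --> X](mul0r (1 - q)^-1); apply: cvgMl.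
  by apply: cvg_expr; rewrite ger0_norm.
apply/cvgrPdist_le => e e0; near=> N.
have /andP[h0 h1] := ln_series_remainder N q01.
rewrite /series /= ger0_norm // (le_trans h1) //.
rewrite -[leLHS]subr0 (le_trans (ler_norm _)) // distrC.
by near: N; move/cvgrPdist_le : H; apply.
Unshelve. all: by end_near. Qed.

End LogarithmicSeries.

(** * The integral representation of [digamma x - ln x] *)

Section DigammaIntegral.
Context {R : realType}.
Local Notation Ioo := (`](0 : R), +oo[%classic).
Local Notation intble f := ((@mu R).-integrable Ioo (EFin \o f)).
Implicit Types (x t s : R).

(* Binet's kernel: [digamma x - ln x] is minus its Laplace transform. *)
Definition binet t : R := (1 - expR (- t))^-1 - t^-1.

Lemma onem_exp_gt0 t : 0 < t -> 0 < 1 - expR (- t).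
Proof. by move=> t0; rewrite subr_gt0 expR_lt1 oppr_lt0. Qed.

Lemma onem_exp_le t : 1 - expR (- t) <= t.
Proof. by have := expR_ge1Dx (- t); lra. Qed.

(** Both bounds come from [e^y >= 1 + y], at [y = - t] and at [y = t]. *)
Lemma binet_bound t : 0 < t -> 0 <= binet t <= 1.
Proof.
move=> t0; have e0 := onem_exp_gt0 t0; apply/andP; split.
  by rewrite /binet subr_ge0 lef_pV2 ?posrE // onem_exp_le.
rewrite /binet lerBlDr.
have -> : (1 - expR (- t))^-1 = 1 + expR (- t) / (1 - expR (- t)).
  by field; rewrite gt_eqF.
rewrite lerD2l ler_pdivrMr // mulrC ler_pdivlMr //.
have : expR (- t) * (1 + t) <= expR (- t) * expR t.
  by rewrite ler_pM2l ?expR_gt0 // expR_ge1Dx.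
by rewrite -expRD addNr expR0; lra.
Qed.

Lemma intble_exp x : 0 < x -> intble (fun t => expR (- (x * t))).
Proof.
move=> x0; apply: eq_intble (intble_powR_exp ltr01 x0) => t t0.
by rewrite subrr powRr0 mul1r.
Qed.

Lemma Rintegral_exp x : 0 < x ->
  \int[mu]_(t in Ioo) expR (- (x * t)) = x^-1.
Proof.
move=> x0; rewrite -[RHS]opprK -[RHS]sub0r.
pose F t : R := - (x^-1 * expR (- (x * t))).
have Fd t : is_derive t 1 F (expR (- (x * t))).
  by rewrite /F; derv; field; rewrite gt_eqF.
apply: (@Rintegral_Ioo_FTC _ F).
- by move=> t _; eapply der_continuous; der.
- exact: intble_exp.
- have -> : - x^-1 = F 0 by rewrite /F mulr0 oppr0 expR0 mulr1.
  exact/cvg_at_right_filter/(der_continuous (Fd 0)).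
- apply: (@cvg_pinfty_inv _ _ _ (x^-1 * x^-1)) => t t0.
  rewrite subr0 normrN ger0_norm; last by rewrite mulr_ge0 ?expR_ge0 ?invr_ge0 ?ltW.
  rewrite -mulrA.
  rewrite ler_pM2l ?invr_gt0 // expRN -invfM lef_pV2 ?posrE ?expR_gt0 ?mulr_gt0 //.
  by have := expR_ge1Dx (x * t); lra.
Qed.

Lemma intble_bounded_exp (f : R -> R) x : 0 < x -> measurable_fun Ioo f ->
  (forall t, 0 < t -> 0 <= f t <= 1) -> intble (fun t => f t * expR (- (x * t))).
Proof.
move=> x0 mf f01; apply: intble_le (intble_exp x0) _.
  apply: measurable_funM => //.
  exact: intble_measurable (intble_exp x0).
move=> t t0; have /andP[f0 f1] := f01 t t0.
by rewrite normrM !ger0_norm ?expR_ge0 // ler_piMl ?expR_ge0.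
Qed.

Lemma Rintegral_bounded_exp (f : R -> R) x : 0 < x -> measurable_fun Ioo f ->
  (forall t, 0 < t -> 0 <= f t <= 1) ->
  0 <= \int[mu]_(t in Ioo) (f t * expR (- (x * t))) <= x^-1.
Proof.
move=> x0 mf f01; apply/andP; split.
  apply: Rintegral_ge0 => t; rewrite IooE => /f01/andP[f0 _].
  by rewrite mulr_ge0 ?expR_ge0.
rewrite -Rintegral_exp //; apply: le_Rintegral => //.
- exact: intble_bounded_exp.
- exact: intble_exp.
- move=> t; rewrite IooE => /f01/andP[_ f1].
  by rewrite ler_piMl ?expR_ge0.
Qed.

Lemma measurable_binet : measurable_fun Ioo binet.
Proof.
apply: measurable_Ioo_der => t t0; eexists; rewrite /binet; der.
- by rewrite gt_eqF // onem_exp_gt0.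
- by rewrite gt_eqF.
Qed.

Lemma cst_eq0_of_inv_bound (c C : R) :
  (forall x, 0 < x -> `|c| <= C / x) -> c = 0.
Proof.
move=> H.
have K t : 0 < t -> `|(fun=> c) t - 0| <= C / t by rewrite subr0 => /H.
exact: (cvg_unique _ (cvg_cst c) (cvg_pinfty_inv K)).
Qed.

(** Both sides have the same derivative in [x] and lie between [0] and [1 / x], so their difference
    [D] is a constant that tends to zero. *)
Lemma frullani x : 0 < x ->
  \int[mu]_(t in Ioo) ((1 - expR (- t)) / t * expR (- (x * t))) =
  ln (x + 1) - ln x.
Proof.
pose h t : R := (1 - expR (- t)) / t.
have h01 t : 0 < t -> 0 <= h t <= 1.
  move=> t0; rewrite /h divr_ge0 ?(ltW t0) ?(ltW (onem_exp_gt0 t0)) //=.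
  by rewrite ler_pdivrMr // mul1r onem_exp_le.
have mh : measurable_fun Ioo h.
  by apply: measurable_Ioo_der => t t0; eexists; rewrite /h; der; rewrite gt_eqF.
pose P x := \int[mu]_(t in Ioo) (h t * expR (- (x * t))).
pose D x := P x - (ln (x + 1) - ln x).
have Dd (y : R) : 0 < y -> is_derive y 1 D 0.
  move=> y0; have y1 : 0 < y + 1 by rewrite addr_gt0.
  have Pd : is_derive y 1 P
      (\int[mu]_(t in Ioo) (- (expR (- (y * t)) - expR (- ((y + 1) * t))))).
    apply: (@is_derive_Rintegral _ _
      (fun y t => - (expR (- (y * t)) - expR (- ((y + 1) * t)))) y (y / 2) (2 * y)
      (fun t => expR (- (y / 2 * t)))).
    - by apply/andP; split; lra.
    - by move=> z /andP[z1 z2]; apply: intble_bounded_exp => //; lra.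
    - move=> z t _ t0; rewrite /h; derv.
      rewrite (_ : - ((z + 1) * t) = - (z * t) + - t); last by ring.
      rewrite expRD; field.
      by rewrite gt_eqF.
    - by apply: intble_exp; lra.
    - move=> z t /andP[z1 z2] t0; rewrite normrN ger0_norm; last first.
        by rewrite subr_ge0 ler_expR; nra.
      rewrite lerBlDr -[leLHS]addr0 lerD ?expR_ge0 // ler_expR; nra.
  rewrite /D; apply: (der_val (der_add Pd _)).
    by der => //.
  rewrite /=.
  rewrite (Rintegral_Ioo_eq
    (g := fun t => - 1 * (expR (- (y * t)) - expR (- ((y + 1) * t))))).
    rewrite RintegralZl // ?RintegralB // ?Rintegral_exp //.
    + by field; rewrite !gt_eqF.
    + exact: intble_exp.
    + exact: intble_exp.
    + by apply: intbleB; exact: intble_exp.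
  by move=> t _; rewrite mulN1r.
have D0 : D 1 = 0.
  apply: (@cst_eq0_of_inv_bound _ 2) => y y0.
  rewrite -(derive0_cst Dd y0) /D.
  have /andP[p0 p1] := Rintegral_bounded_exp y0 mh h01.
  rewrite -/(P y) in p0 p1.
  have l0 : 0 <= ln (y + 1) - ln y.
    by rewrite subr_ge0 ler_ln ?posrE ?lerDl // addr_gt0.
  have l1 : ln (y + 1) - ln y <= y^-1.
    rewrite -ln_div ?posrE ?addr_gt0 // (le_trans (ln_le_subr1 _)) ?divr_gt0 ?addr_gt0 //.
    by rewrite mulrDl mul1r divff ?gt_eqF // addrC addKr.
  rewrite ler_norml; apply/andP; split; lra.
move=> x0; have := derive0_cst Dd x0; rewrite D0 /D => /eqP.
by rewrite subr_eq0 => /eqP.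
Qed.

(** The difference [D] of the two sides has period one, by the recurrences of [digamma] and of [J],
    and [|D y| <= 1 / y]; hence [D x = D (x + k)] is arbitrarily small. *)
Lemma digamma_integral x : 0 < x ->
  digamma x - ln x = - \int[mu]_(t in Ioo) (binet t * expR (- (x * t))).
Proof.
pose J x := \int[mu]_(t in Ioo) (binet t * expR (- (x * t))).
pose D x := digamma x - ln x + J x.
have Jrec (y : R) : 0 < y -> J (y + 1) - J y = - (y^-1 - (ln (y + 1) - ln y)).
  move=> y0; have y1 : 0 < y + 1 by rewrite addr_gt0.
  have bi (z : R) : 0 < z -> intble (fun t => binet t * expR (- (z * t))).
    move=> z0; apply: intble_bounded_exp => //; first exact: measurable_binet.
    exact: binet_bound.
  have hi : intble (fun t => (1 - expR (- t)) / t * expR (- (y * t))).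
    apply: intble_bounded_exp => //.
      by apply: measurable_Ioo_der => t t0; eexists; der; rewrite gt_eqF.
    move=> t t0; rewrite divr_ge0 ?(ltW t0) ?(ltW (onem_exp_gt0 t0)) //=.
    by rewrite ler_pdivrMr // mul1r onem_exp_le.
  rewrite /J -RintegralB //; try exact: bi.
  rewrite -frullani // -Rintegral_exp // -RintegralB //; last exact: intble_exp.
  rewrite -[RHS]mulN1r -RintegralZl //; last first.
    by apply: intbleB => //; exact: intble_exp.
  (* Pointwise this is [binet t * (1 - expR (- t)) = 1 - (1 - expR (- t)) / t]. *)
  apply: Rintegral_Ioo_eq => t t0.
  rewrite (_ : - ((y + 1) * t) = - (y * t) + - t); last by ring.
  rewrite expRD /binet; field.
  by rewrite gt_eqF //= gt_eqF // onem_exp_gt0.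
have Drec (y : R) : 0 < y -> D (y + 1) = D y.
  move=> y0; apply/eqP; rewrite -subr_eq0; apply/eqP.
  have -> : D (y + 1) - D y =
    (digamma (y + 1) - digamma y) - (ln (y + 1) - ln y) + (J (y + 1) - J y).
    have aux (a b c d e f : R) :
      (a - b + c) - (d - e + f) = (a - d) - (b - e) + (c - f) by ring.
    exact: aux.
  by rewrite Jrec // digamma_rec //; ring.
have Dbound y : 0 < y -> `|D y| <= y^-1.
  move=> y0; have /andP[d0 d1] := digamma_sub_ln_bound y0.
  have /andP[j0 j1] := Rintegral_bounded_exp y0 measurable_binet binet_bound.
  rewrite -/(J y) in j0 j1.
  by rewrite /D ler_norml; apply/andP; split; lra.
move=> x0; apply/eqP; rewrite -subr_eq0 opprK -/(J x); apply/eqP.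
rewrite -/(D x).
have Dk k : D (x + k%:R) = D x.
  elim: k => [|k IH]; first by rewrite addr0.
  by rewrite -natr1 addrA Drec // ltr_wpDr.
apply/eqP; rewrite -normr_le0; apply/ler_addgt0Pr => e e0; rewrite add0r.
have [k ke] : exists k : nat, e^-1 < k%:R.
  exists (Num.truncn e^-1).+1; exact: truncnS_gt.
rewrite -(Dk k) (le_trans (Dbound _ _)) ?ltr_wpDr //.
rewrite -[leRHS]invrK lef_pV2 ?posrE ?invr_gt0 ?ltr_wpDr //.
by rewrite (le_trans (ltW ke)) // lerDr ltW.
Qed.

End DigammaIntegral.

(** * The Herglotz function as an integral, and its derivative *)

Section HerglotzIntegral.
Context {R : realType}.
Local Notation Ioo := (`](0 : R), +oo[%classic).
Local Notation intble f := ((@mu R).-integrable Ioo (EFin \o f)).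
Implicit Types (x t s : R).

(** With [E = e^(s / 2) >= 1 + s / 2] one gets [E (E - s / 2) >= E >= 1]. The bound keeps both the
    simple zero at [0] and the exponential growth. *)
Lemma expR_sub1_ge s : 0 <= s -> s / 2 * expR (s / 2) <= expR s - 1.
Proof.
move=> s0; have -> : expR s = expR (s / 2) * expR (s / 2).
  by rewrite -expRD; congr expR; lra.
have := expR_ge1Dx (s / 2); have := expR_gt0 (s / 2).
by nra.
Qed.

Lemma expR_sub1_gt0 s : 0 < s -> 0 < expR s - 1.
Proof. by move=> s0; rewrite subr_gt0 expR_gt1. Qed.

(* With [r^2 >= 1 / (e^s - 1)], [- ln (1 - e^-s) <= ln (1 + r^2)] *)
(* [<= 2 ln (1 + r) <= 2 r]. *)
Lemma neg_ln_onem_exp_le s : 0 < s ->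
  - ln (1 - expR (- s)) <= 2 * expR (- (2^-1 * ln (s / 2)) - s / 4).
Proof.
move=> s0; pose r := expR (- (2^-1 * ln (s / 2)) - s / 4); rewrite -/r.
have r0 : 0 < r by exact: expR_gt0.
have s2 : 0 < s / 2 by rewrite divr_gt0.
have e0 := expR_sub1_gt0 s0.
have rE : r ^+ 2 = (s / 2 * expR (s / 2))^-1.
  rewrite /r -expRM_natl -[X in (X * _)^-1]lnK ?posrE // -expRD -expRN.
  by congr expR; lra.
have r2 : (expR s - 1)^-1 <= r ^+ 2.
  rewrite rE lef_pV2 ?posrE ?mulr_gt0 ?expR_gt0 //.
  by apply: expR_sub1_ge; exact: ltW.
rewrite -lnV ?posrE ?onem_exp_gt0 //.
have -> : (1 - expR (- s))^-1 = 1 + (expR s - 1)^-1.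
  rewrite expRN; field.
  by rewrite !gt_eqF //= expR_gt0.
apply: (@le_trans _ _ (ln ((1 + r) ^+ 2))).
  rewrite ler_ln ?posrE ?exprn_gt0 ?addr_gt0 ?invr_gt0 //.
  by nra.
rewrite lnXn ?addr_gt0 // mulr2n.
by have := @le_ln1Dx _ r (lt_trans (ltrN10 R) r0); lra.
Qed.

(** By [neg_ln_onem_exp_le] the function is dominated by a multiple of [t^(- 1 / 2) e^(- x t / 4)],
    the case [s = 1 / 2] of [intble_powR_exp]. *)
Lemma intble_ln_onem_exp x : 0 < x -> intble (fun t => - ln (1 - expR (- (x * t)))).
Proof.
move=> x0; have x4 : 0 < x / 4 by rewrite divr_gt0.
have h2 : 0 < 2^-1 :> R by rewrite invr_gt0.
apply: intble_le (intbleZ (2 * expR (- (2^-1 * ln (x / 2)))) (intble_powR_exp h2 x4)) _.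
  apply: measurable_Ioo_der => t t0; eexists; der.
  by rewrite onem_exp_gt0 // mulr_gt0.
move=> t t0; have xt0 : 0 < x * t by rewrite mulr_gt0.
rewrite ger0_norm; last first.
  by rewrite oppr_ge0 ln_le0 // gerBl expR_ge0.
apply: le_trans (neg_ln_onem_exp_le xt0) _.
rewrite powR_gt0E // -(mulrA 2) -!expRD ler_pM2l // ler_expR.
have -> : x * t / 2 = x / 2 * t by ring.
rewrite lnM ?posrE // ?divr_gt0 //.
by lra.
Qed.

Lemma intble_binet_mul (f : R -> R) : intble f -> intble (fun t => binet t * f t).
Proof.
move=> fi; apply: (intble_le (g := fun t => `|f t|)).
- by apply: measurable_funM; [exact: measurable_binet | exact: intble_measurable].
- exact: integrable_norm.
- move=> t t0; have /andP[b0 b1] := binet_bound t0.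
  by rewrite normrM ger0_norm // ler_piMl.
Qed.

(** Inserting [digamma_integral] into the series leaves the logarithmic series of [q = e^(- x t)]
    under the integral. Its partial sums are nonnegative and at most [- ln (1 - q)], which is
    integrable, so dominated convergence applies. *)
Lemma herglotz_integral x : 0 < x ->
  herglotz x = \int[mu]_(t in Ioo) (binet t * ln (1 - expR (- (x * t)))).
Proof.
move=> x0; apply/cvg_lim => //.
pose c k : R := - k.+1%:R^-1.
pose f k t : R := binet t * expR (- (k.+1%:R * x * t)).
have kx k : 0 < k.+1%:R * x by rewrite mulr_gt0 // ltr0n.
have fi k : intble (f k).
  by apply: intble_bounded_exp => //; [exact: measurable_binet|exact: binet_bound].
have E N : series (fun k => (digamma (k.+1%:R * x) - ln (k.+1%:R * x)) / k.+1%:R) N =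
    \int[mu]_(t in Ioo) (\sum_(k <- index_iota 0 N) c k * f k t).
  rewrite Rintegral_Ioo_sum //; apply: eq_bigr => k _.
  by rewrite digamma_integral // /c mulrC mulNr mulrN.
have q01 t : 0 < t -> 0 <= expR (- (x * t)) < 1.
  by move=> t0; rewrite expR_ge0 expR_lt1 oppr_lt0 mulr_gt0.
have S N t : \sum_(k <- index_iota 0 N) c k * f k t =
    - (binet t * series (fun k => expR (- (x * t)) ^+ k.+1 / k.+1%:R) N).
  rewrite /series mulr_sumr -sumrN; apply: eq_bigr => k _.
  rewrite /c /f -expRM_natl.
  rewrite (_ : - (k.+1%:R * x * t) = k.+1%:R * - (x * t)); last by ring.
  by ring.
rewrite (funext E).
apply: (Rintegral_dominated_cvg (g := fun t => - ln (1 - expR (- (x * t))))).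
- move=> N; apply: intble_measurable; by apply: intble_sum => k _; exact: fi.
- move=> t t0; rewrite (funext (fun N => S N t)).
  rewrite -[X in _ --> X]opprK; apply: cvgN.
  rewrite -[X in _ --> X]mulrN; apply: cvgMr; exact: cvg_ln_series (q01 t t0).
- exact: intble_ln_onem_exp.
- move=> N t t0; rewrite S normrN normrM.
  have /andP[b0 b1] := binet_bound t0.
  have /andP[h0 h1] := ln_series_remainder N (q01 t t0).
  have s0 : 0 <= series (fun k => expR (- (x * t)) ^+ k.+1 / k.+1%:R) N.
    by apply: sumr_ge0 => k _; rewrite divr_ge0 ?exprn_ge0 ?expR_ge0.
  rewrite !ger0_norm //; apply: le_trans (ler_piMl s0 b1) _.
  by rewrite -subr_ge0.
Qed.

Definition herglotz_deriv x : R :=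
  \int[mu]_(t in Ioo) (binet t * (t / (expR (x * t) - 1))).

Lemma div_expR_sub1_bound x t : 0 < x -> 0 < t ->
  0 <= t / (expR (x * t) - 1) <= 2 / x * expR (- (x / 2 * t)).
Proof.
move=> x0 t0; have xt : 0 < x * t by rewrite mulr_gt0.
have e0 := expR_sub1_gt0 xt.
rewrite divr_ge0 ?(ltW t0) ?(ltW e0) //= ler_pdivrMr //.
have h := expR_sub1_ge (ltW xt).
have p0 : 0 <= 2 / x * expR (- (x / 2 * t)).
  by rewrite mulr_ge0 ?expR_ge0 // divr_ge0 // ltW.
apply: le_trans (ler_wpM2l p0 h).
rewrite expRN (_ : x * t / 2 = x / 2 * t); last by ring.
rewrite le_eqVlt; apply/orP; left; apply/eqP; field.
by rewrite !gt_eqF // expR_gt0.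
Qed.

Lemma intble_div_expR_sub1 x : 0 < x -> intble (fun t => t / (expR (x * t) - 1)).
Proof.
move=> x0; have x2 : 0 < x / 2 by rewrite divr_gt0.
apply: intble_le (intbleZ (2 / x) (intble_exp x2)) _.
  apply: measurable_Ioo_der => t t0; eexists; der.
  by rewrite gt_eqF // expR_sub1_gt0 // mulr_gt0.
by move=> t t0; have /andP[h0 h1] := div_expR_sub1_bound x0 t0; rewrite ger0_norm.
Qed.

Lemma is_derive_herglotz x : 0 < x -> is_derive x 1 herglotz (herglotz_deriv x).
Proof.
move=> x0; apply: (@der_eq_near _
  (fun y => \int[mu]_(t in Ioo) (binet t * ln (1 - expR (- (y * t)))))).
  by near=> y; rewrite herglotz_integral //; near: y; exact: near_gt0.
have x4 : 0 < x / 4 by rewrite divr_gt0.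
(* For [y > x / 2] the bound of [div_expR_sub1_bound] is at most [4 / x * expR (- (x / 4 * t))],
   uniformly in [y]. *)
apply: (@is_derive_Rintegral _ _ (fun y t => binet t * (t / (expR (y * t) - 1)))
  x (x / 2) (2 * x) (fun t => 4 / x * expR (- (x / 4 * t)))).
- by apply/andP; split; lra.
- move=> y /andP[y1 y2]; apply: intble_binet_mul.
  have y0 : 0 < y by lra.
  by have := intbleN (intble_ln_onem_exp y0); apply: eq_intble => t _; rewrite opprK.
- move=> y t /andP[y1 y2] t0.
  have y0 : 0 < y by lra.
  have yt : 0 < y * t by rewrite mulr_gt0.
  derv; first by rewrite onem_exp_gt0.
  have e0 := expR_sub1_gt0 yt; have e1 := expR_gt0 (y * t).
  rewrite expRN; field.
  by rewrite !gt_eqF.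
- by apply: intbleZ; exact: intble_exp.
- move=> y t /andP[y1 y2] t0; have y0 : 0 < y by lra.
  have /andP[b0 b1] := binet_bound t0.
  have /andP[h0 h1] := div_expR_sub1_bound y0 t0.
  rewrite ger0_norm; last exact: mulr_ge0.
  apply: le_trans (ler_piMl h0 b1) _; apply: le_trans h1 _.
  apply: ler_pM; rewrite ?expR_ge0 ?divr_ge0 ?(ltW y0) //.
    rewrite ler_pdivrMr // mulrAC ler_pdivlMr //; lra.
  by rewrite ler_expR; nra.
Unshelve. all: by end_near. Qed.

End HerglotzIntegral.

(** * Derivatives of the dilogarithm and of the Rogers dilogarithm on the unit interval *)

Section RogersDilogarithm.
Context {R : realType}.

Lemma cvg_pseries_bounded (c : nat -> R) (K : R) :
  (forall i, `|c i| <= 1) -> 0 <= K < 1 -> cvgn (pseries c K).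
Proof.
move=> c1 /andP[K0 K1]; apply: normed_cvg.
apply: (@series_le_cvg _ _ (geometric 1 K)).
- by move=> n /=.
- by move=> n /=; rewrite mul1r exprn_ge0.
- move=> n /=; rewrite mul1r normrM normrX (ger0_norm K0).
  by rewrite ler_piMl ?exprn_ge0.
- by apply: is_cvg_geometric_series; rewrite ger0_norm.
Qed.

(** At [i = 0] this is [0], the inverse of zero being zero, so the power series agrees with [dilog],
    whose first term has exponent one. *)
Let dcoef (i : nat) : R := (i%:R ^+ 2)^-1.

Lemma norm_inv_natS_le1 (k : nat) : `|k.+1%:R^-1 : R| <= 1.
Proof. by rewrite ger0_norm ?invr_ge0 // invf_le1 ?ltr0n // ler1n. Qed.

Lemma dcoef_diffs (i : nat) : pseries_diffs dcoef i = i.+1%:R^-1.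
Proof.
rewrite /pseries_diffs /dcoef expr2 invfM mulrA divff ?mul1r // pnatr_eq0 //.
Qed.

(** Termwise differentiation gives the sum of [u^i / (i + 1)], and [u] times it is the series of
    [- ln (1 - u)]. *)
Lemma is_derive_dilog (u : R) : 0 < u < 1 ->
  is_derive u 1 dilog (- ln (1 - u) / u).
Proof.
move=> /andP[u0 u1].
have dE (y : R) : 0 <= y < 1 -> dilog y = limn (pseries dcoef y).
  move=> y01; have cv : cvgn (pseries dcoef y).
    apply: cvg_pseries_bounded => // -[|i].
      by rewrite /dcoef expr0n invr0 normr0.
    rewrite /dcoef -exprVn normrX exprn_ile1 ?normr_ge0 //.
    exact: norm_inv_natS_le1.
  apply/cvg_lim => //; move/cvg_ex : cv => [l Hl].
  rewrite (cvg_lim _ Hl) //; move: Hl; rewrite -cvg_shiftS => Hl.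
  apply: cvg_trans Hl; apply: near_eq_cvg; apply: nearW => n /=.
  rewrite /pseries /series /= big_nat_recl // /dcoef expr0n invr0 mul0r add0r.
  by apply: eq_bigr => k _; rewrite mulrC.
have c1 i : `|pseries_diffs dcoef i| <= 1.
  by rewrite dcoef_diffs; exact: norm_inv_natS_le1.
(* A radius strictly between [u] and [1]. The series and its first two formal derivatives converge
   there, their coefficients being at most [1]. *)
pose K := (1 + u) / 2.
have K01 : 0 <= K < 1 by apply/andP; rewrite /K; split; lra.
have H : is_derive u 1 (fun y => limn (pseries dcoef y))
    (limn (pseries (pseries_diffs dcoef) u)).
  apply: (@pseries_snd_diffs _ _ K).
  - apply: cvg_pseries_bounded => // -[|i].
      by rewrite /dcoef expr0n invr0 normr0.
    rewrite /dcoef -exprVn normrX exprn_ile1 ?normr_ge0 //.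
    exact: norm_inv_natS_le1.
  - exact: cvg_pseries_bounded.
  - apply: cvg_pseries_bounded => // i; rewrite {1}/pseries_diffs dcoef_diffs.
    rewrite ger0_norm ?mulr_ge0 ?invr_ge0 // ler_pdivrMr ?ltr0n // mul1r ler_nat.
    by [].
  - by rewrite !ger0_norm ?ltW // /K; lra.
have -> : - ln (1 - u) / u = limn (pseries (pseries_diffs dcoef) u).
  have u01 : 0 <= u < 1 by rewrite ltW.
  have cv := cvg_pseries_bounded c1 u01.
  move/cvg_ex : cv => [l Hl]; rewrite (cvg_lim _ Hl) //.
  have L := cvg_ln_series u01.
  have L' : u * pseries (pseries_diffs dcoef) u k @[k --> \oo] --> u * l.
    exact: cvgMr.
  have E k : u * pseries (pseries_diffs dcoef) u k =
      series (fun k => u ^+ k.+1 / k.+1%:R) k.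
    rewrite /pseries /series /= mulr_sumr; apply: eq_bigr => i _.
    by rewrite dcoef_diffs exprS; ring.
  have {}L' : series (fun k => u ^+ k.+1 / k.+1%:R) k @[k --> \oo] --> u * l.
    by apply: cvg_trans L'; apply: near_eq_cvg; apply: nearW => k; rewrite E.
  by rewrite (cvg_unique _ L L') // mulrC mulKf // gt_eqF.
apply: (der_eq_near _ H); near=> y; rewrite dE //; apply/andP; split.
  by apply: ltW; near: y; exact: near_gt0.
by near: y; exact: lt_nbhsl.
Unshelve. all: by end_near. Qed.

Lemma is_derive_rogersL (u : R) : 0 < u < 1 ->
  is_derive u 1 rogersL (- (ln (1 - u) / u + ln u / (1 - u)) / 2).
Proof.
move=> u01; have /andP[u0 u1] := u01.
have u1' : 0 < 1 - u by rewrite subr_gt0.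
apply: (@der_eq_near _ (fun y => dilog y + ln y * ln (1 - y) / 2)).
  near=> y.
  have y0 : 0 < y by near: y; exact: near_gt0.
  have y1 : y < 1 by near: y; exact: lt_nbhsl.
  by rewrite /rogersL /rogersL01 ltNge ltW //= ltNge (ltW y1) /= gt_eqF // lt_eqF.
apply: (@der_val _ _ _ (- ln (1 - u) / u +
  ((ln u * ln (1 - u)) * 0 + 2^-1 * (ln u * ((1 - u)^-1 * (0 - 1)) +
    ln (1 - u) * (u^-1 * 1))))).
  apply: der_add; first exact: is_derive_dilog.
  by der.
by field; rewrite !gt_eqF.
Unshelve. all: by end_near. Qed.

End RogersDilogarithm.

(** * Elementary integrals and the kernel attached to a cone *)

Section LogarithmicIntegral.
Context {R : realType}.
Local Notation Ioo := (`](0 : R), +oo[%classic).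
Local Notation intble f := ((@mu R).-integrable Ioo (EFin \o f)).

Lemma cvg_sum_seq (I : eqType) (r : seq I) (T : Type) (F : set_system T)
    (FF : Filter F) (f : I -> T -> R) (l : I -> R) :
  (forall i, i \in r -> f i t @[t --> F] --> l i) ->
  \sum_(i <- r) f i t @[t --> F] --> \sum_(i <- r) l i.
Proof.
elim: r => [|i r IH] fl.
  by rewrite big_nil; under eq_fun do rewrite big_nil; exact: cvg_cst.
rewrite big_cons; under eq_fun do rewrite big_cons.
apply: cvgD; first by apply: fl; rewrite mem_head.
by apply: IH => j jr; apply: fl; rewrite in_cons jr orbT.
Qed.

(** With [s = al * t], the error [ln ((1 - e^(- s)) / s)] lies in [[- s, 0]], because
    [e^(- s) <= (1 - e^(- s)) / s <= 1]. *)
Lemma cvg_ln_onem_exp_at_right0 (al : R) : 0 < al ->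
  ln (1 - expR (- (al * t))) - ln t @[t --> 0^'+] --> ln al.
Proof.
move=> al0; apply: (@cvg_at_right0_powR _ _ _ al 1) => // t t0.
rewrite powRr1 ?(ltW t0) //; set s := al * t.
have s0 : 0 < s by rewrite mulr_gt0.
have e0 := onem_exp_gt0 s0.
have -> : ln (1 - expR (- s)) - ln t - ln al = ln ((1 - expR (- s)) / s).
  by rewrite ln_div ?posrE // /s lnM ?posrE //; ring.
have q0 : 0 < (1 - expR (- s)) / s by rewrite divr_gt0.
rewrite ler0_norm; last first.
  by apply: ln_le0; rewrite ler_pdivrMr // mul1r onem_exp_le.
rewrite lerNl -[leLHS]expRK ler_ln ?posrE ?expR_gt0 //.
rewrite ler_pdivlMr //.
have : expR (- s) * (1 + s) <= expR (- s) * expR s.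
  by rewrite ler_pM2l ?expR_gt0 // expR_ge1Dx.
by rewrite -expRD addNr expR0; lra.
Qed.

Lemma cvg_ln_onem_exp_pinfty (al : R) : 0 < al ->
  ln (1 - expR (- (al * t))) @[t --> +oo] --> 0.
Proof.
move=> al0; apply: (@cvg_pinfty_inv _ _ _ al^-1) => t t0.
have s0 : 0 < al * t by rewrite mulr_gt0.
rewrite subr0 ler0_norm; last by apply: ln_le0; rewrite gerBl expR_ge0.
have e0 := expR_sub1_gt0 s0; have e1 := onem_exp_gt0 s0.
rewrite -lnV ?posrE //.
have -> : (1 - expR (- (al * t)))^-1 = 1 + (expR (al * t) - 1)^-1.
  by rewrite expRN; field; rewrite !gt_eqF //= expR_gt0.
apply: le_trans (le_ln1Dx _) _.
  by apply: lt_trans (ltrN10 R) _; rewrite invr_gt0.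
rewrite -invfM lef_pV2 ?posrE //.
by have := expR_ge1Dx (al * t); lra.
Qed.

(* The antiderivative is [\sum k_i / al_i * ln (1 - e^(- al_i t))], whose *)
(* logarithmic singularity at 0 cancels by hypothesis. *)
Lemma Rintegral_sum_inv_expR_sub1 (r : seq (R * R)) :
  (forall p, p \in r -> 0 < p.2) ->
  \sum_(p <- r) p.1 / p.2 = 0 ->
  intble (fun t => \sum_(p <- r) p.1 * (expR (p.2 * t) - 1)^-1) ->
  \int[mu]_(t in Ioo) (\sum_(p <- r) p.1 * (expR (p.2 * t) - 1)^-1) =
  - \sum_(p <- r) p.1 / p.2 * ln p.2.
Proof.
move=> r0 rs ri; rewrite -[RHS]sub0r.
pose F t := \sum_(p <- r) p.1 / p.2 * ln (1 - expR (- (p.2 * t))).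
apply: (@Rintegral_Ioo_FTC _ F) => //.
- move=> t t0; apply: der_sum => p /r0 p0.
  have s0 : 0 < p.2 * t by rewrite mulr_gt0.
  have e0 := expR_sub1_gt0 s0; have e1 := onem_exp_gt0 s0.
  derv => //.
  rewrite expRN; field.
  by rewrite !gt_eqF //= expR_gt0.
- move=> t t0; eapply der_continuous; apply: der_sum => p /r0 p0.
  have s0 : 0 < p.2 * t by rewrite mulr_gt0.
  have e0 := expR_sub1_gt0 s0.
  apply: (@der_val _ _ _ (- (expR (p.2 * t) - 1) ^- 2 * (p.2 * expR (p.2 * t)) * p.1)).
    by derv; [rewrite gt_eqF | ring].
  exact: erefl.
(* By [rs], subtracting [ln t] from every logarithm does not change the sum. *)
- apply: (@cvg_trans _ ((fun t => \sum_(p <- r) p.1 / p.2 *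
      (ln (1 - expR (- (p.2 * t))) - ln t)) t @[t --> 0^'+])).
    apply: near_eq_cvg; apply: nearW => t; rewrite /F.
    under eq_bigr do rewrite mulrBr.
    by rewrite sumrB -mulr_suml rs mul0r subr0.
  apply: cvg_sum_seq => p /r0 p0; apply: cvgMr.
  exact: cvg_ln_onem_exp_at_right0.
- rewrite [X in _ --> X](_ : 0 = \sum_(p <- r) p.1 / p.2 * 0); last first.
    by rewrite -mulr_suml mulr0.
  apply: cvg_sum_seq => p /r0 p0; apply: cvgMr.
  exact: cvg_ln_onem_exp_pinfty.
Qed.

(** The integrable part of [t] times the generating function of a cone, see [cone_kernelE]; for
    [w2 = 1] it is the integrand of [herglotz_deriv w1]. *)
Definition cone_kernel (w1 w2 t : R) : R :=
  binet (w2 * t) * (t / (expR (w1 * t) - 1)).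

Lemma cone_kernelE (w1 w2 t : R) : 0 < w1 -> 0 < w2 -> 0 < t ->
  t * conegen (t * w1) (t * w2) =
  cone_kernel w1 w2 t + w2^-1 * (expR (w1 * t) - 1)^-1.
Proof.
move=> w10 w20 t0; rewrite /cone_kernel /conegen /binet !(mulrC t).
have e1 : 0 < expR (w1 * t) - 1 by rewrite expR_sub1_gt0 // mulr_gt0.
have e2 : 0 < 1 - expR (- (w2 * t)) by rewrite onem_exp_gt0 // mulr_gt0.
by field; rewrite !gt_eqF.
Qed.

Lemma cone_kernel_der (w1 w2 t : R) : 0 < w1 -> 0 < w2 -> 0 < t ->
  exists d, is_derive t 1 (cone_kernel w1 w2) d.
Proof.
move=> w10 w20 t0.
have e1 : 0 < expR (w1 * t) - 1 by rewrite expR_sub1_gt0 // mulr_gt0.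
have e2 : 0 < 1 - expR (- (w2 * t)) by rewrite onem_exp_gt0 // mulr_gt0.
by eexists; rewrite /cone_kernel /binet; der; rewrite gt_eqF // mulr_gt0.
Qed.

Lemma intble_cone_kernel (w1 w2 : R) : 0 < w1 -> 0 < w2 ->
  intble (cone_kernel w1 w2).
Proof.
move=> w10 w20; apply: intble_le (intble_div_expR_sub1 w10) _.
  by apply: measurable_Ioo_der => t t0; exact: cone_kernel_der.
move=> t t0; have wt : 0 < w2 * t by rewrite mulr_gt0.
have /andP[b0 b1] := binet_bound wt.
have /andP[h0 _] := div_expR_sub1_bound w10 t0.
by rewrite normrM !ger0_norm // ler_piMl.
Qed.

(** Rescaling [t] by [w2] turns the kernel of [(w1, w2)] into that of [(w1 / w2, 1)]. Multiplied by
    [n], this is the derivative of [herglotz] composed with the matrix. *)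
Lemma Rintegral_cone_kernel (w1 w2 : R) : 0 < w1 -> 0 < w2 ->
  \int[mu]_(t in Ioo) cone_kernel w1 w2 t = herglotz_deriv (w1 / w2) / w2 ^+ 2.
Proof.
move=> w10 w20; have w0 : 0 < w1 / w2 by rewrite divr_gt0.
pose f := cone_kernel (w1 / w2) 1.
have fE (t : R) : 0 < t -> f (w2 * t) = w2 * cone_kernel w1 w2 t.
  move=> t0; rewrite /f /cone_kernel mul1r.
  rewrite (_ : w1 / w2 * (w2 * t) = w1 * t); last by rewrite mulrA divfK // gt_eqF.
  by ring.
have -> : herglotz_deriv (w1 / w2) = \int[mu]_(t in Ioo) f t.
  by apply: Rintegral_Ioo_eq => t t0; rewrite /f /cone_kernel mul1r.
have ci : intble (cone_kernel w1 w2) by exact: intble_cone_kernel.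
rewrite -(@Rintegral_Ioo_scale _ f w2) //.
- rewrite (Rintegral_Ioo_eq fE) RintegralZl //; field.
  by rewrite gt_eqF.
- move=> t t0; have [d] := cone_kernel_der w0 ltr01 t0.
  exact: der_continuous.
- exact: intble_cone_kernel.
- by apply: eq_intble (intbleZ w2 ci) => t t0; rewrite fE.
Qed.

End LogarithmicIntegral.

(** * Divisor sums and pairings with functions of the second row *)

Section HeckePeriods.
Context {R : realType}.
Local Notation Ioo := (`](0 : R), +oo[%classic).
Local Notation intble f := ((@mu R).-integrable Ioo (EFin \o f)).

Variables (n : nat) (Tn : hecke_ring).
Hypotheses (n0 : (0 < n)%N) (Tn_part : hecke_part n Tn)
  (Tn_periods : hecke_on_periods n Tn)
  (Tn_ge0 : forall g : pmx, g \in msupp Tn -> has_nonneg_repr g).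

Let n0R : 0 < n%:R :> R. Proof. by rewrite ltr0n. Qed.

Let eqh := @eq_hsum R _ _ n0 Tn_part Tn_ge0.
Let hper := @hsum_periods R _ _ n0 Tn_part Tn_periods Tn_ge0.

Lemma det_num_gt0 (a b c d : nat) (x : R) : 0 < x -> (a * d = b * c + n)%N ->
  [/\ (0 < a)%N, 0 < a%:R :> R, 0 < a%:R * x + b%:R, 0 < c%:R * x + d%:R
    & a%:R * d%:R - b%:R * c%:R = n%:R :> R].
Proof.
move=> x0 det; have a0 : (0 < a)%N by nia.
have d0 : (0 < d)%N by nia.
split => //; rewrite ?ltr0n //.
- by rewrite ltr_wpDr // mulr_gt0 // ltr0n.
- by rewrite ltr_wpDl ?ltr0n // mulr_ge0 // ltW.
- by rewrite -!natrM det natrD addrAC subrr add0r.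
Qed.

Lemma sum_divisors_cst (k : nat -> R) : \sum_(d <- divisors n) \sum_(b < d) k d =
  \sum_(d <- divisors n) d%:R * k d.
Proof. by apply: eq_bigr => d _; rewrite sumr_const card_ord mulr_natl. Qed.

Lemma eq_sum_divisors (f g : nat -> R) :
  (forall l, (0 < l)%N -> (l %| n)%N -> f l = g l) ->
  \sum_(l <- divisors n) f l = \sum_(l <- divisors n) g l.
Proof.
move=> fg; apply: eq_big_seq => l; rewrite -dvdn_divisors // => dvl.
by apply: fg => //; exact: dvdn_gt0 dvl.
Qed.

Lemma sigma_div : \sum_(l <- divisors n) (n%:R / l%:R) = sigma n :> R.
Proof.
rewrite /sigma -[RHS](sum_divisors_div (fun d => d%:R)) //.
apply: eq_sum_divisors => l l0 dvl.
by rewrite -{1}(divnK dvl) natrM mulfK // pnatr_eq0 -lt0n.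
Qed.

(** Exchanging [l] and [n / l] gives [hecke_logcoef] the shape in which the logarithms arise from
    the integral. *)
Lemma hecke_logcoefE :
  hecke_logcoef n = 2^-1 * sigma n * ln n%:R -
    \sum_(l <- divisors n) n%:R / l%:R * ln l%:R :> R.
Proof.
have -> : \sum_(l <- divisors n) n%:R / l%:R * ln l%:R =
    \sum_(l <- divisors n) l%:R * (ln n%:R - ln l%:R) :> R.
  rewrite -[RHS](sum_divisors_div (fun l => l%:R * (ln n%:R - ln l%:R))) //.
  apply: eq_sum_divisors => l l0 dvl.
  have l0R : 0 < l%:R :> R by rewrite ltr0n.
  have -> : (n %/ l)%:R = n%:R / l%:R :> R.
    by rewrite -{2}(divnK dvl) natrM mulfK // gt_eqF.
  by rewrite ln_div ?posrE //; ring.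
rewrite /hecke_logcoef /sigma -mulrA mulr_suml !mulr_sumr -sumrB.
apply: eq_sum_divisors => l l0 dvl.
have l0R : 0 < l%:R :> R by rewrite ltr0n.
rewrite ln_div ?posrE ?exprn_gt0 // lnXn // mulr2n.
by field.
Qed.

Lemma absz_repr_det (g : pmx) : g \in msupp Tn ->
  muln (absz (repr g 0 0)) (absz (repr g 1 1)) =
  addn (muln (absz (repr g 0 1)) (absz (repr g 1 0))) n.
Proof.
move=> gT; have [a [b [c [d [det _ rE]]]]] := nonneg_repr_entries n0 Tn_part Tn_ge0 gT.
by case: rE => ->; rewrite ?oppmx2 !mxE /= ?abszN ?absz_nat.
Qed.

Lemma Rintegral_hsum (Q : nat -> nat -> nat -> nat -> R -> R) :
  (forall a b c d, (a * d = b * c + n)%N -> intble (Q a b c d)) ->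
  \int[mu]_(t in Ioo) hsum (fun a b c d => Q a b c d t) Tn =
  hsum (fun a b c d => \int[mu]_(t in Ioo) Q a b c d t) Tn /\
  intble (fun t => hsum (fun a b c d => Q a b c d t) Tn).
Proof.
move=> Qi.
pose f (g : pmx) t := Q (absz (repr g 0 0)) (absz (repr g 0 1))
  (absz (repr g 1 0)) (absz (repr g 1 1)) t.
have fi (g : pmx) : g \in msupp Tn -> intble (f g).
  by move=> /absz_repr_det/Qi.
split; last exact: (intble_sum (fun g => ratr (mcoeff g Tn)) fi).
exact: (Rintegral_Ioo_sum (fun g => ratr (mcoeff g Tn)) fi).
Qed.

(** A function of the second row alone is invariant under [gamma |-> T gamma]. For the matrices of
    [hecke_infty] that row is [(0, d)], and [(d, 0)] after right multiplication by [S], for each of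
    the [d] values of [b]. *)
Lemma hsum_bottom (P : int -> int -> R) :
  (forall c d : int, P (- c) (- d) = P c d) ->
  hsum (fun a b c d => P c d - P a b) Tn =
  \sum_(d <- divisors n) d%:R * (P 0 d - P d 0).
Proof.
move=> PN; rewrite -sum_divisors_cst.
by rewrite -(@hper (fun _ _ c d => P c d)).
Qed.

(** * Identities between derivatives at a fixed point *)

Section FixedPoint.
Variable x : R.
Hypothesis x0 : 0 < x.

Local Notation lf a b := (a%:R * x + b%:R).

(** With [w1 = a x + b] and [w2 = c x + d], the relation [a w2 - c w1 = n] turns the summand into
    [a / w1 - c / w2], to which [hsum_bottom] applies. *)
Lemma hsum_inv_w1w2 :
  hsum (fun a b c d => n%:R / (lf a b * lf c d)) Tn = sigma n / x.
Proof.
pose P (c d : int) : R := - (c%:~R / (c%:~R * x + d%:~R)).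
transitivity (hsum (fun a b c d => P c d - P a b) Tn).
  apply: eqh => a b c d det; have [_ a0 h1 h2 <-] := det_num_gt0 x0 det.
  by rewrite /P -!pmulrn; field; rewrite !gt_eqF.
rewrite hsum_bottom; last first.
  move=> c d; rewrite /P.
  have -> : (- c)%:~R * x + (- d)%:~R = - (c%:~R * x + d%:~R) :> R.
    by rewrite !mulrNz mulNr opprD.
  by rewrite mulrNz invrN mulrNN.
rewrite /sigma mulr_suml; apply: eq_sum_divisors => l l0 dvl.
have l0R : 0 < l%:R :> R by rewrite ltr0n.
by rewrite /P -!pmulrn mul0r oppr0 sub0r opprK addr0; field; rewrite !gt_eqF.
Qed.

(** The summand is the derivative of [y + 1 / y] at [y = gamma(x)], so this settles the terms with
    [pi ^+ 2 / 12]. *)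
Lemma hsum_inv_sqr :
  hsum (fun a b c d => n%:R / lf c d ^+ 2 - n%:R / lf a b ^+ 2) Tn =
  sigma n * (1 - x ^- 2).
Proof.
pose P (c d : int) : R := n%:R / (c%:~R * x + d%:~R) ^+ 2.
transitivity (hsum (fun a b c d => P c d - P a b) Tn).
  by apply: eqh => a b c d det; rewrite /P -!pmulrn.
rewrite hsum_bottom; last first.
  by move=> c d; rewrite /P !mulrNz mulNr -opprD sqrrN.
rewrite -sigma_div mulr_suml; apply: eq_sum_divisors => l l0 dvl.
have l0R : 0 < l%:R :> R by rewrite ltr0n.
by rewrite /P -!pmulrn mul0r add0r addr0; field; rewrite !gt_eqF.
Qed.

(** The absolute values in [P] make it invariant under a change of sign; where [c = 0], the factor
    [c] removes the default value of [ln c]. *)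
Lemma hsum_log :
  hsum (fun a b c d => 2^-1 * (a%:R / lf a b * (ln (lf a b) - ln a%:R + ln n%:R) -
    c%:R / lf c d * (ln (lf c d) - ln c%:R + ln n%:R))) Tn =
  sigma n / (2 * x) * (ln x + ln n%:R).
Proof.
pose P (c d : int) : R := - (2^-1 * (c%:~R / (c%:~R * x + d%:~R) *
  (ln `|c%:~R * x + d%:~R| - ln `|c%:~R| + ln n%:R))).
transitivity (hsum (fun a b c d => P c d - P a b) Tn).
  apply: eqh => a b c d det; have [_ a0 h1 h2 _] := det_num_gt0 x0 det.
  rewrite /P -!pmulrn (gtr0_norm h1) (gtr0_norm h2) !normr_nat.
  by rewrite mulrBr addrC opprK.
rewrite hsum_bottom; last first.
  move=> c d; rewrite /P.
  have -> : (- c)%:~R * x + (- d)%:~R = - (c%:~R * x + d%:~R) :> R.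
    by rewrite !mulrNz mulNr opprD.
  by rewrite mulrNz invrN mulrNN !normrN.
rewrite /sigma -mulrA mulr_suml; apply: eq_sum_divisors => l l0 dvl.
have l0R : 0 < l%:R :> R by rewrite ltr0n.
rewrite /P -!pmulrn !mul0r mulr0 oppr0 sub0r opprK addr0 normr_nat.
rewrite (gtr0_norm (mulr_gt0 l0R x0)) lnM ?posrE //.
by field; rewrite !gt_eqF.
Qed.

(** This is [hsum_conegen] times [n t], split by [cone_kernelE]: the integrable kernels are on the
    left, the terms singular at [t = 0] on the right. *)
Lemma cone_kernel_identity (t : R) : 0 < t ->
  hsum (fun a b c d => n%:R * cone_kernel (lf a b) (lf c d) t) Tn -
  \sum_(l <- divisors n) n%:R * l%:R * cone_kernel (l%:R * x) l%:R t =
  \sum_(l <- divisors n) n%:R * (expR (l%:R * x * t) - 1)^-1 -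
  hsum (fun a b c d => n%:R / lf c d * (expR (lf a b * t) - 1)^-1) Tn.
Proof.
move=> t0; have := hsum_conegen n0 Tn_part Tn_periods Tn_ge0 x0 t0.
move=> /(congr1 (fun z => n%:R * t * z)); rewrite -hsumZ => H.
have E1 : hsum (fun a b c d => n%:R * t *
    conegen (t * lf a b) (t * lf c d)) Tn =
  hsum (fun a b c d => n%:R * cone_kernel (lf a b) (lf c d) t) Tn +
  hsum (fun a b c d => n%:R / lf c d * (expR (lf a b * t) - 1)^-1) Tn.
  rewrite -hsumD; apply: eqh => a b c d det.
  have [_ a0 h1 h2 _] := det_num_gt0 x0 det.
  by rewrite -mulrA cone_kernelE //; ring.
have E2 : n%:R * t * \sum_(l <- divisors n) l%:R * conegen (t * (l%:R * x)) (t * l%:R) =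
  \sum_(l <- divisors n) n%:R * l%:R * cone_kernel (l%:R * x) l%:R t +
  \sum_(l <- divisors n) n%:R * (expR (l%:R * x * t) - 1)^-1.
  rewrite mulr_sumr -big_split; apply: eq_sum_divisors => l l0 dvl /=.
  have l0R : 0 < l%:R :> R by rewrite ltr0n.
  rewrite (_ : _ * (_ * conegen _ _) =
    n%:R * l%:R * (t * conegen (t * (l%:R * x)) (t * l%:R))); last by ring.
  rewrite cone_kernelE ?mulr_gt0 // mulrDr; congr (_ + _).
  by rewrite mulrA mulfK // gt_eqF.
by move: H; rewrite E1 E2 => H; lra.
Qed.

(** Integrate [cone_kernel_identity] over [t]. The left side yields values of [herglotz_deriv]; the
    right side is evaluated by [Rintegral_sum_inv_expR_sub1], whose cancellation hypothesis is
    [hsum_inv_w1w2]. *)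
Lemma hsum_herglotz_deriv :
  hsum (fun a b c d => n%:R / lf c d ^+ 2 * herglotz_deriv (lf a b / lf c d) -
    n%:R / (lf a b * lf c d) * ln (lf a b)) Tn =
  sigma n * herglotz_deriv x -
    \sum_(l <- divisors n) n%:R / (l%:R * x) * ln (l%:R * x).
Proof.
have l0R l : l \in divisors n -> 0 < l%:R :> R.
  by rewrite -dvdn_divisors // => /(dvdn_gt0 n0); rewrite ltr0n.
pose L t := hsum (fun a b c d => n%:R * cone_kernel (lf a b) (lf c d) t) Tn.
pose M t : R := \sum_(l <- divisors n) n%:R * l%:R * cone_kernel (l%:R * x) l%:R t.
have ci a b c d : (a * d = b * c + n)%N ->
    intble (fun t => n%:R * cone_kernel (lf a b) (lf c d) t).
  move=> det; have [_ a0 h1 h2 _] := det_num_gt0 x0 det.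
  by apply/intbleZ/intble_cone_kernel.
have [Li LE] : intble L /\ \int[mu]_(t in Ioo) L t =
    hsum (fun a b c d => n%:R / lf c d ^+ 2 * herglotz_deriv (lf a b / lf c d)) Tn.
  have [-> ?] := Rintegral_hsum ci; split => //.
  apply: eqh => a b c d det; have [_ a0 h1 h2 _] := det_num_gt0 x0 det.
  rewrite RintegralZl ?Rintegral_cone_kernel //; last exact: intble_cone_kernel.
  by rewrite mulrCA mulrC.
have mi l : l \in divisors n -> intble (cone_kernel (l%:R * x) l%:R).
  by move=> /l0R l0; apply: intble_cone_kernel => //; exact: mulr_gt0.
have Mi : intble M by exact: intble_sum.
have ME : \int[mu]_(t in Ioo) M t = sigma n * herglotz_deriv x.
  rewrite Rintegral_Ioo_sum // -sigma_div mulr_suml.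
  apply: eq_big_seq => l /l0R l0.
  rewrite Rintegral_cone_kernel ?mulr_gt0 // (_ : l%:R * x / l%:R = x).
    by field; rewrite gt_eqF.
  by rewrite mulrC mulKf // gt_eqF.
(* All pairs of a coefficient and an exponent on the right side, from the divisors and from the
   matrices. *)
pose r : seq (R * R) :=
  [seq (n%:R, l%:R * x) | l <- divisors n] ++
  [seq (- (ratr (mcoeff g Tn) * (n%:R /
      lf (absz (repr g 1 0)) (absz (repr g 1 1)))),
    lf (absz (repr g 0 0)) (absz (repr g 0 1))) | g <- msupp Tn].
have rsum (f : R -> R) : \sum_(p <- r) p.1 * f p.2 =
    \sum_(l <- divisors n) n%:R * f (l%:R * x) -
    hsum (fun a b c d => n%:R / lf c d * f (lf a b)) Tn.
  rewrite /r big_cat !big_map /=; congr (_ + _).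
  rewrite /hsum hpairE -sumrN; apply: eq_bigr => g _.
  by ring.
have r0 p : p \in r -> 0 < p.2.
  rewrite mem_cat => /orP[/mapP[l /l0R l0 ->]|/mapP[g gT ->]] /=.
    exact: mulr_gt0.
  by have [] := det_num_gt0 x0 (absz_repr_det gT).
have rs : \sum_(p <- r) p.1 / p.2 = 0.
  rewrite (rsum (fun y => y^-1)).
  have -> : hsum (fun a b c d => n%:R / lf c d / lf a b) Tn = sigma n / x.
    rewrite -hsum_inv_w1w2; apply: eqh => a b c d det.
    by rewrite invfM mulrA mulrAC.
  rewrite -sigma_div mulr_suml; apply/eqP; rewrite subr_eq0; apply/eqP.
  by apply: eq_bigr => l _; rewrite invfM mulrA.
have rE t : 0 < t -> \sum_(p <- r) p.1 * (expR (p.2 * t) - 1)^-1 = L t - M t.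
  by move=> t0; rewrite (rsum (fun y => (expR (y * t) - 1)^-1)) -cone_kernel_identity.
(* Each term is singular at [0]; integrability of the sum is inherited from the kernels through
   [rE]. *)
have ri : intble (fun t => \sum_(p <- r) p.1 * (expR (p.2 * t) - 1)^-1).
  by apply: eq_intble (intbleB Li Mi) => t t0; rewrite rE.
have := Rintegral_sum_inv_expR_sub1 r0 rs ri.
rewrite (Rintegral_Ioo_eq rE) RintegralB // LE ME.
have -> : \sum_(p <- r) p.1 / p.2 * ln p.2 =
    \sum_(l <- divisors n) n%:R / (l%:R * x) * ln (l%:R * x) -
    hsum (fun a b c d => n%:R / (lf a b * lf c d) * ln (lf a b)) Tn.
  under eq_bigr do rewrite -mulrA.
  rewrite (rsum (fun y => y^-1 * ln y)); congr (_ - _).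
    by apply: eq_bigr => l _; rewrite mulrA.
  by apply: eqh => a b c d det; rewrite invfM; ring.
by rewrite hsumB => H; lra.
Qed.

End FixedPoint.

(** * Derivatives of the summands, and the conclusion *)

Lemma is_derive_mod_herglotz (y : R) : 0 < y -> is_derive y 1 mod_herglotz
  (herglotz_deriv y + pi ^+ 2 / 12 * (1 - y ^- 2) - ln y / (2 * y)).
Proof.
move=> y0.
have D : is_derive y 1 (fun z => - herglotz 1 + pi ^+ 2 / 12 * (z - 2 + z^-1) -
    ln z * ln z / 4) (pi ^+ 2 / 12 * (1 - y ^- 2) - ln y / (2 * y)).
  derv; rewrite ?gt_eqF //.
  by field; rewrite gt_eqF.
have -> : mod_herglotz = (fun z : R => herglotz z + (- herglotz 1 +
    pi ^+ 2 / 12 * (z - 2 + z^-1) - ln z * ln z / 4)).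
  by apply/funext => z; rewrite /mod_herglotz expr2 !addrA.
apply: (der_val (der_add (is_derive_herglotz y0) D)).
by rewrite addrA.
Qed.

Lemma is_derive_mobius (a b c d : nat) (x : R) : 0 < x -> (a * d = b * c + n)%N ->
  is_derive x 1 (fun y => (a%:R * y + b%:R) / (c%:R * y + d%:R))
    (n%:R / (c%:R * x + d%:R) ^+ 2).
Proof.
move=> x0 det; have [_ a0 h1 h2 <-] := det_num_gt0 x0 det.
derv; first by rewrite gt_eqF.
by field; rewrite gt_eqF.
Qed.

Definition hecke_summand (a b c d : nat) (x : R) : R :=
  let y := (a%:R * x + b%:R) / (c%:R * x + d%:R) in
  mod_herglotz y - (if c == 0%N then 0 else rogersL (y / (a%:R / c%:R))).

Lemma slash0_mod_herglotz (x : R) : 0 < x ->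
  slash0 mod_herglotz Tn x - \sum_(g <- msupp Tn | ~~ fixes_infty g)
    ratr (mcoeff g Tn) * rogersL (mobius g x / mobius_infty g) =
  hsum (fun a b c d => hecke_summand a b c d x) Tn.
Proof.
move=> x0; rewrite /slash0 [X in _ - X]big_mkcond -sumrB /hsum hpairE.
apply: eq_big_seq => g gT.
have [a [b [c [d [det gE rE]]]]] := nonneg_repr_entries n0 Tn_part Tn_ge0 gT.
have -> : mobius g x = (a%:R * x + b%:R) / (c%:R * x + d%:R).
  by rewrite gE mobiusE /mobius_mx !mxE /= -!pmulrn.
have -> : fixes_infty g = (c == 0%N) by rewrite gE fixes_inftyE !mxE.
have -> : mobius_infty g = a%:R / c%:R :> R.
  by rewrite gE mobius_inftyE !mxE /= -!pmulrn.
have [-> -> -> ->] : [/\ absz (repr g 0 0) = a, absz (repr g 0 1) = b,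
    absz (repr g 1 0) = c & absz (repr g 1 1) = d].
  by case: rE => ->; rewrite ?oppmx2 !mxE /= ?abszN ?absz_nat.
rewrite /hecke_summand [RHS]mulrBr; congr (_ - _).
by case: (c == 0%N); rewrite ?mulr0.
Qed.

(** The derivative of one summand, arranged to match [hsum_herglotz_deriv], [hsum_inv_sqr] and
    [hsum_log]: the term [n / (w1 w2) ln w1] is subtracted in the first group and compensated in the
    last. *)
Definition hecke_summand_deriv (a b c d : nat) (x : R) : R :=
  let w1 := a%:R * x + b%:R in let w2 := c%:R * x + d%:R in
  n%:R / w2 ^+ 2 * herglotz_deriv (w1 / w2) - n%:R / (w1 * w2) * ln w1 +
  pi ^+ 2 / 12 * (n%:R / w2 ^+ 2 - n%:R / w1 ^+ 2) +
  2^-1 * (a%:R / w1 * (ln w1 - ln a%:R + ln n%:R) -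
    c%:R / w2 * (ln w2 - ln c%:R + ln n%:R)).

(** The Rogers argument is [u = c w1 / (a w2)], with [1 - u = n / (a w2)]. For [c > 0] both are
    positive, so [is_derive_rogersL] applies and its logarithms split into those of [n], [a], [c],
    [w1], [w2]. *)
Lemma is_derive_hecke_summand (a b c d : nat) (x : R) : 0 < x ->
  (a * d = b * c + n)%N ->
  is_derive x 1 (hecke_summand a b c d) (hecke_summand_deriv a b c d x).
Proof.
move=> x0 det; have [_ a0 h1 h2 nE] := det_num_gt0 x0 det.
rewrite /hecke_summand_deriv; set w1 := a%:R * x + b%:R in h1 *.
set w2 := c%:R * x + d%:R in h2 *.
pose gam (y : R) := (a%:R * y + b%:R) / (c%:R * y + d%:R).
have gd : is_derive x 1 gam (n%:R / w2 ^+ 2) by exact: is_derive_mobius.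
have y0 : 0 < w1 / w2 by rewrite divr_gt0.
have Hd := @is_derive1_comp R mod_herglotz gam x _ _ (is_derive_mod_herglotz y0) gd.
have lnw : ln (w1 / w2) = ln w1 - ln w2 by rewrite ln_div ?posrE.
rewrite lnw in Hd.
(* For [c = 0] there is no Rogers term, and [n = a d] with [w2 = d] reduces [ln n - ln a] to
   [ln w2]. *)
have [c0|cn0] := eqVneq c 0%N.
  have -> : hecke_summand a b c d = mod_herglotz \o gam.
    by apply/funext => y; rewrite /hecke_summand ifT ?subr0 // c0.
  apply: (der_val Hd).
  have w2E : w2 = d%:R by rewrite /w2 c0 mul0r add0r.
  have -> : ln n%:R = ln a%:R + ln w2.
    by rewrite -lnM ?posrE // w2E -nE c0 mulr0 subr0.
  have -> : n%:R = a%:R * w2 by rewrite w2E -nE c0 mulr0 subr0.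
  rewrite c0 !mul0r subr0; field.
  by rewrite !gt_eqF.
have c0 : 0 < c%:R :> R by rewrite ltr0n lt0n.
have -> : hecke_summand a b c d = (fun y =>
    (mod_herglotz \o gam) y - (rogersL \o (fun y => gam y / (a%:R / c%:R))) y).
  by apply/funext => y; rewrite /hecke_summand (negbTE cn0).
set u := w1 / w2 / (a%:R / c%:R).
have uB : 1 - u = n%:R / (a%:R * w2).
  by rewrite /u -nE /w1 /w2; field; rewrite -/w2 !gt_eqF.
have u0 : 0 < u by rewrite !divr_gt0.
have u1 : 0 < 1 - u by rewrite uB divr_gt0 ?mulr_gt0.
have u01 : 0 < u < 1 by rewrite u0 -subr_gt0.
have ud : is_derive x 1 (fun y => gam y / (a%:R / c%:R))
    (n%:R / w2 ^+ 2 / (a%:R / c%:R)).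
  apply: (der_val (der_mul gd (der_cst _ _))).
  by rewrite mulr0 add0r mulrC.
have Ld := @is_derive1_comp R rogersL (fun y => gam y / (a%:R / c%:R)) x _ _
  (is_derive_rogersL u01) ud.
apply: (der_val (der_add Hd (der_opp Ld))).
have -> : ln (1 - u) = ln n%:R - (ln a%:R + ln w2).
  by rewrite uB ln_div ?lnM ?posrE ?mulr_gt0.
have -> : ln u = ln w1 - ln w2 - (ln a%:R - ln c%:R).
  by rewrite /u ln_div ?ln_div ?posrE ?divr_gt0.
have w1E : a%:R * w2 - c%:R * w1 = n%:R by rewrite -nE /w1 /w2; ring.
rewrite uB; have -> : u = c%:R * w1 / (a%:R * w2).
  by rewrite /u; field; rewrite !gt_eqF.
(* What remains is a rational identity in which the five logarithms are free and only
   [a w2 - c w1 = n] is used. *)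
move: (ln n%:R) (ln a%:R) (ln c%:R) (ln w1) (ln w2) => ln_n ln_a ln_c ln1 ln2.
have nn0 : a%:R * w2 - c%:R * w1 != 0 by rewrite w1E gt_eqF.
rewrite -w1E; field.
by rewrite nn0 !gt_eqF.
Qed.

Lemma is_derive_hsum (Q : nat -> nat -> nat -> nat -> R -> R)
    (dQ : nat -> nat -> nat -> nat -> R) (x : R) :
  (forall a b c d, (a * d = b * c + n)%N ->
    is_derive x 1 (Q a b c d) (dQ a b c d)) ->
  is_derive x 1 (fun y => hsum (fun a b c d => Q a b c d y) Tn) (hsum dQ Tn).
Proof.
move=> Qd; apply: der_sum => g /absz_repr_det/Qd H.
apply: (der_val (der_mul (der_cst _ _) H)).
by rewrite mulr0 addr0.
Qed.

Lemma hsum_hecke_summand_deriv (x : R) : 0 < x ->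
  hsum (fun a b c d => hecke_summand_deriv a b c d x) Tn =
  sigma n * (herglotz_deriv x + pi ^+ 2 / 12 * (1 - x ^- 2) - ln x / (2 * x)) +
  hecke_logcoef n / x.
Proof.
move=> x0; rewrite /hecke_summand_deriv /= 2!hsumD hsumZ.
rewrite hsum_herglotz_deriv // hsum_inv_sqr // hsum_log // hecke_logcoefE.
have -> : \sum_(l <- divisors n) n%:R / (l%:R * x) * ln (l%:R * x) =
    x^-1 * (\sum_(l <- divisors n) n%:R / l%:R * ln l%:R) + sigma n / x * ln x.
  rewrite -sigma_div mulr_sumr !mulr_suml -big_split; apply: eq_sum_divisors => l l0 dvl.
  have l0R : 0 < l%:R :> R by rewrite ltr0n.
  by rewrite lnM ?posrE //=; field; rewrite !gt_eqF.
by field; rewrite gt_eqF.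
Qed.

(** [Psi] is the left side minus [hecke_logcoef n * ln x]; its derivative vanishes on the half-line,
    so it equals its value at [1]. *)
Lemma hecke_herglotz : exists K : R, forall x : R, 0 < x ->
  slash0 mod_herglotz Tn x - sigma n * mod_herglotz x
    - \sum_(g <- msupp Tn | ~~ fixes_infty g)
        ratr (mcoeff g Tn) * rogersL (mobius g x / mobius_infty g)
  = hecke_logcoef n * ln x + K.
Proof.
pose Psi x := hsum (fun a b c d => hecke_summand a b c d x) Tn -
  sigma n * mod_herglotz x - hecke_logcoef n * ln x.
have Psid (x : R) : 0 < x -> is_derive x 1 Psi 0.
  move=> x0.
  have D1 := is_derive_hsum (fun a b c d => is_derive_hecke_summand x0).
  have D2 := der_mul (der_cst (sigma n) x) (is_derive_mod_herglotz x0).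
  have D3 := der_mul (der_cst (hecke_logcoef n) x) (is_derive1_ln x0).
  apply: (der_val (der_add (der_add D1 (der_opp D2)) (der_opp D3))).
  by rewrite hsum_hecke_summand_deriv //; ring.
exists (Psi 1) => x x0; rewrite -(derive0_cst Psid x0) /Psi -slash0_mod_herglotz //.
by ring.
Qed.

End HeckePeriods.

Theorem theorem2 (R : realType) (n : nat) (Tn : hecke_ring) :
  (0 < n)%N ->
  hecke_part n Tn ->
  hecke_on_periods n Tn ->
  (forall g : pmx, g \in msupp Tn -> has_nonneg_repr g) ->
  exists K : R, forall x : R, 0 < x ->
    slash0 mod_herglotz Tn x - sigma n * mod_herglotz x
      - \sum_(g <- msupp Tn | ~~ fixes_infty g)
          ratr (mcoeff g Tn) * rogersL (mobius g x / mobius_infty g)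
    = hecke_logcoef n * ln x + K.
Proof. exact: hecke_herglotz. Qed.
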